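(* ($\mathrm{ZFC}$) $\mathbb W\models\mathrm{BZFC}$; that is, for every axiom $\varphi$ of $\mathrm{BZFC}$, $\mathrm{ZFC}$ proves the relativization $\varphi^{\mathbb W,T}$.
   Context: LOGIC BS4. BS4 is a four-valued first-order logic with primitive symbols $\sim$ (native negation), $\wedge,\vee,\to,\bot,\forall,\exists,=$; $\varphi\leftrightarrow\psi$ is $(\varphi\to\psi)\wedge(\psi\to\varphi)$. Vocabularies contain only constant and relation symbols. A T/F-model $\mathcal M$ has a (nonempty) domain $M$, an element $c^{\mathcal M}\in M$ for each constant, for each $n$-ary relation symbol $R$ two sets $(R^{\mathcal M})^+,(R^{\mathcal M})^-\subseteq M^n$ (with no relation assumed between them), the relation $=^+$ which is true identity on $M$, and a symmetric binary relation $=^-$ on $M$. Truth $\models^T$ and falsity $\models^F$ are defined recursively: an atomic formula is true iff its $+$ interpretation holds and false iff its $-$ interpretation holds; $\sim\varphi$ is true iff $\varphi$ is false, and false iff $\varphi$ is true; $\varphi\wedge\psi$ is true iff both are true, false iff at least one is false; $\varphi\vee\psi$ is true iff at least one is true, false iff both are false; $\varphi\to\psi$ is true iff ($\varphi$ true implies $\psi$ true), false iff $\varphi$ is true and $\psi$ is false; $\exists x\varphi$ is true iff some instance is true, false iff all instances are false; $\forall x\varphi$ is true iff all instances are true, false iff some instance is false; $\bot$ is never true and always false. ABBREVIATIONS. $\varphi\Rightarrow\psi$ is $(\varphi\to\psi)\wedge(\sim\psi\to\sim\varphi)$; $\varphi\Leftrightarrow\psi$ is $(\varphi\leftrightarrow\psi)\wedge(\sim\varphi\leftrightarrow\sim\psi)$;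 $\neg\varphi$ is $\varphi\to\bot$; $!\varphi$ is $\sim\neg\varphi$; $?\varphi$ is $\neg\sim\varphi$; $\circ\varphi$ is $!\varphi\leftrightarrow{?}\varphi$ (''$\varphi$ is classical''). $x\neq y$, $x\notin y$, $x\not\subseteq y$ are $\sim(x=y)$, $\sim(x\in y)$, $\sim(x\subseteq y)$. SETS. The language is $\{\in\}$. $x=\{y:\varphi(y)\}$ abbreviates $\forall y(y\in x\Leftrightarrow\varphi(y))$. $x\subseteq y$ is $\forall z(z\in x\Rightarrow z\in y)$. $x^!=\{y:{!}(y\in x)\}$, $x^?=\{y:{?}(y\in x)\}$. A set $x$ is classical if $\forall y(y\in x^!\leftrightarrow y\in x^?)$. $\{u_0,\dots,u_n\}=\{y:{!}(y=u_0)\vee\dots\vee{!}(y=u_n)\}$. $\langle u,v\rangle=\{\{u\},\{u,v\}\}$; the ordered pair $(a,b)$ of BZFC is the set with $(a,b)^!=\{\langle x,\varnothing\rangle:x\in a^!\}\cup\{\langle y,\{\varnothing\}\rangle:y\in b^!\}$ and $(a,b)^?$ given likewise from $a^?,b^?$. $A\times B=\{(a,b):a\in A\wedge b\in B\}$; $\mathrm{dom}(R)=\{x:\exists y\,(x,y)\in R\}$. For a classical set $A$, a classical function from $A$ to $B$ is a classical set $f\subseteq A\times B$ with $\mathrm{dom}(f)=A$ and $\forall x\forall y\forall z(((x,y)\in f\wedge(x,z)\in f)\to{!}(y=z))$. AXIOMS OF PZFC (in BS4; schemas for all formulas $\varphi$, with parameters). Extensionality: $\forall x\forall y(x=y\Leftrightarrow\forall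 z(z\in x\Leftrightarrow z\in y))$. Comprehension: $\forall u\exists x\forall y(y\in x\Leftrightarrow(y\in u\wedge\varphi(y)))$. Classical Superset: $\forall x\exists C(x\subseteq C\wedge\forall y\,{\circ}(y\in C))$. Replacement: $[\forall x\forall y\,{\circ}\varphi(x,y)\wedge\forall x\exists y(\varphi(x,y)\wedge\forall z(\varphi(x,z)\to{!}(y=z)))]\to\forall x\exists y\forall z(z\in y\Leftrightarrow\exists w(w\in x\wedge\varphi(w,z)))$. Pairing: $\forall u\forall v\exists x\forall y(y\in x\Leftrightarrow({!}(y=u)\vee{!}(y=v)))$. Power Set: $\forall u\exists v\forall x(x\in v\Leftrightarrow{!}(x\subseteq u))$. Union: $\forall u\exists x\forall y(y\in x\Leftrightarrow\exists z(y\in z\wedge z\in u))$. Infinity: $\exists x(\varnothing\in x\wedge\forall y(y\in x\to y\cup\{y\}\in x))$. Foundation: $\forall x(\forall y(y\in x^!\cup x^?\to\varphi(y))\to\varphi(x))\to\forall u\,\varphi(u)$. Choice: for every classical $u$, if $\forall x(x\in u\to\exists y(y\in x))$ then there is a classical function $f$ with $\mathrm{dom}(f)=u$ and $f(x)\in x$ for all $x\in u$. ACLA: $\exists x(x^!\not\subseteq x^?)\wedge\exists x(x^?\not\subseteq x^!)$. $\mathrm{BZFC}$ is $\mathrm{PZFC}+\mathrm{ACLA}$. THE CLASS $\mathbb W$ (defined in ZFC, with ordinary ordered pairs and power sets). $W_0=\varnothing$, $W_{\alpha+1}=\mathscr P(W_\alpha)\times\mathscr P(W_\alpha)$, $W_\lambda=\bigcup_{\alpha<\lambda}W_\alpha$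 for limit $\lambda$, $\mathbb W=\bigcup_{\alpha\in\mathrm{Ord}}W_\alpha$. On $\mathbb W$: $(a,b)\in^+(c,d)$ iff $(a,b)\in c$; $(a,b)\in^-(c,d)$ iff $(a,b)\notin d$; $(a,b)=^+(c,d)$ iff $(a,b)=(c,d)$; $(a,b)=^-(c,d)$ iff $\exists z\in a\setminus d$ or $\exists z\in c\setminus b$. For each formula $\varphi$ of the language of set theory, $\varphi^{\mathbb W,T}$ and $\varphi^{\mathbb W,F}$ are the (classical) formulas of ZFC obtained by the recursive truth and falsity clauses above applied to the class-sized T/F-model $(\mathbb W,\in^+,\in^-,=^+,=^-)$, with quantifiers ranging over $\mathbb W$. $\mathbb W\models\Gamma$ means that for every $\varphi\in\Gamma$ there is a proof of $\varphi^{\mathbb W,T}$. *)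

(* Defs.v *)
From Stdlib Require Import List.
Import ListNotations.

(** Both object languages use de Bruijn indices.  There are no function
    symbols and no constants, so the only terms are variables and substitution
    is renaming.  A macro such as [zfSub x y] takes the indices of its free
    variables as seen at the point of use and shifts them under its own
    binders. *)

Definition up (r : nat -> nat) (k : nat) : nat :=
  match k with 0 => 0 | S k => S (r k) end.

(** For [φ] whose variable 0 (resp. variables 0 and 1) is its distinguished
    argument and whose other variables are parameters, [at1 x d] (resp.
    [at2 x y d]) is the renaming producing [φ(x)] (resp. [φ(x, y)]) below [d]
    binders that are not allowed to capture the parameters of [φ]. *)
Definition at1 (x d k : nat) : nat :=
  match k with 0 => x | S k => k + d end.
Definition at2 (x y d k : nat) : nat :=
  match k with 0 => x | 1 => y | S (S k) => k + d end.

(** * Classical first-order logic in the language of set theory *)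

Inductive zf : Type :=
| zfIn  (x y : nat)
| zfEq  (x y : nat)
| zfBot
| zfAnd (φ ψ : zf)
| zfOr  (φ ψ : zf)
| zfImp (φ ψ : zf)
| zfAll (φ : zf)
| zfEx  (φ : zf).

Definition zfNot (φ : zf) : zf := zfImp φ zfBot.
Definition zfIff (φ ψ : zf) : zf := zfAnd (zfImp φ ψ) (zfImp ψ φ).

Declare Scope zf_scope.
Delimit Scope zf_scope with zf.
Bind Scope zf_scope with zf.
Notation "x ∈ y" := (zfIn x y) (at level 70, no associativity) : zf_scope.
Notation "x ≐ y" := (zfEq x y) (at level 70, no associativity) : zf_scope.
Notation "¬ φ" := (zfNot φ) (at level 75, right associativity) : zf_scope.
Notation "φ ∧ ψ" := (zfAnd φ ψ) (at level 80, right associativity) : zf_scope.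
Notation "φ ∨ ψ" := (zfOr φ ψ) (at level 85, right associativity) : zf_scope.
Notation "φ → ψ" := (zfImp φ ψ) (at level 90, right associativity) : zf_scope.
Notation "φ ↔ ψ" := (zfIff φ ψ) (at level 95, no associativity) : zf_scope.
Notation "∀ φ" := (zfAll φ) (at level 200, right associativity) : zf_scope.
Notation "∃ φ" := (zfEx φ) (at level 200, right associativity) : zf_scope.

Fixpoint zf_ren (r : nat -> nat) (φ : zf) : zf :=
  match φ with
  | zfIn x y => zfIn (r x) (r y)
  | zfEq x y => zfEq (r x) (r y)
  | zfBot => zfBot
  | zfAnd φ ψ => zfAnd (zf_ren r φ) (zf_ren r ψ)
  | zfOr φ ψ => zfOr (zf_ren r φ) (zf_ren r ψ)
  | zfImp φ ψ => zfImp (zf_ren r φ) (zf_ren r ψ)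
  | zfAll φ => zfAll (zf_ren (up r) φ)
  | zfEx φ => zfEx (zf_ren (up r) φ)
  end.

(** All free variables of [φ] are below [n]. *)
Fixpoint zf_closed (n : nat) (φ : zf) : Prop :=
  match φ with
  | zfIn x y | zfEq x y => x < n /\ y < n
  | zfBot => True
  | zfAnd φ ψ | zfOr φ ψ | zfImp φ ψ => zf_closed n φ /\ zf_closed n ψ
  | zfAll φ | zfEx φ => zf_closed (S n) φ
  end.

Fixpoint zf_gen (n : nat) (φ : zf) : zf :=
  match n with 0 => φ | S n => zfAll (zf_gen n φ) end.

(** ** Natural deduction *)

Definition zf_inst (t : nat) : zf -> zf := zf_ren (at1 t 0).

Inductive nd : list zf -> zf -> Prop :=
| nd_hyp Γ φ : In φ Γ -> nd Γ φ
| nd_dne Γ φ : nd Γ (zfNot (zfNot φ)) -> nd Γ φ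
| nd_botE Γ φ : nd Γ zfBot -> nd Γ φ
| nd_andI Γ φ ψ : nd Γ φ -> nd Γ ψ -> nd Γ (zfAnd φ ψ)
| nd_andE1 Γ φ ψ : nd Γ (zfAnd φ ψ) -> nd Γ φ
| nd_andE2 Γ φ ψ : nd Γ (zfAnd φ ψ) -> nd Γ ψ
| nd_orI1 Γ φ ψ : nd Γ φ -> nd Γ (zfOr φ ψ)
| nd_orI2 Γ φ ψ : nd Γ ψ -> nd Γ (zfOr φ ψ)
| nd_orE Γ φ ψ χ :
    nd Γ (zfOr φ ψ) -> nd (φ :: Γ) χ -> nd (ψ :: Γ) χ -> nd Γ χ
| nd_impI Γ φ ψ : nd (φ :: Γ) ψ -> nd Γ (zfImp φ ψ)
| nd_impE Γ φ ψ : nd Γ (zfImp φ ψ) -> nd Γ φ -> nd Γ ψ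
| nd_allI Γ φ : nd (map (zf_ren S) Γ) φ -> nd Γ (zfAll φ)
| nd_allE Γ φ t : nd Γ (zfAll φ) -> nd Γ (zf_inst t φ)
| nd_exI Γ φ t : nd Γ (zf_inst t φ) -> nd Γ (zfEx φ)
| nd_exE Γ φ ψ :
    nd Γ (zfEx φ) -> nd (φ :: map (zf_ren S) Γ) (zf_ren S ψ) -> nd Γ ψ
| nd_eqI Γ t : nd Γ (zfEq t t)
| nd_eqE Γ φ s t :
    nd Γ (zfEq s t) -> nd Γ (zf_inst s φ) -> nd Γ (zf_inst t φ).

Definition proves (T : zf -> Prop) (φ : zf) : Prop :=
  exists Γ : list zf, (forall ψ, In ψ Γ -> T ψ) /\ nd Γ φ.

(** ** Set-theoretic vocabulary *)

Section SetVocabulary.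
Local Open Scope zf_scope.

Definition zfSub (x y : nat) : zf := ∀ 0 ∈ S x → 0 ∈ S y.
Definition zfEmpty (x : nat) : zf := ∀ ¬ 0 ∈ S x.
(* s = x ∪ {x} *)
Definition zfSucc (s x : nat) : zf := ∀ 0 ∈ S s ↔ (0 ∈ S x ∨ 0 ≐ S x).
(* s = {u, v} *)
Definition zfUPair (s u v : nat) : zf := ∀ 0 ∈ S s ↔ (0 ≐ S u ∨ 0 ≐ S v).
(* p = {{u}, {u, v}} *)
Definition zfPair (p u v : nat) : zf :=
  ∃ ∃ zfUPair 1 (2 + u) (2 + u) ∧ zfUPair 0 (2 + u) (2 + v)
      ∧ zfUPair (2 + p) 1 0.
(* (x, y) ∈ f *)
Definition zfApp (f x y : nat) : zf :=
  ∃ zfPair 0 (S x) (S y) ∧ 0 ∈ S f.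
(* f is a function with domain d *)
Definition zfFun (f d : nat) : zf :=
  (∀ 0 ∈ S f → ∃ ∃ 1 ∈ 3 + d ∧ zfPair 2 1 0)
  ∧ (∀ 0 ∈ S d → ∃ zfApp (2 + f) 1 0)
  ∧ (∀ ∀ ∀ zfApp (3 + f) 2 1 ∧ zfApp (3 + f) 2 0 → 1 ≐ 0).
(* transitive and strictly well-ordered by ∈ *)
Definition zfOrd (a : nat) : zf :=
  (∀ 0 ∈ S a → zfSub 0 (S a))
  ∧ (∀ 0 ∈ S a → ¬ 0 ∈ 0)
  ∧ (∀ ∀ ∀ 2 ∈ 3 + a ∧ 1 ∈ 3 + a ∧ 0 ∈ 3 + a → 2 ∈ 1 → 1 ∈ 0 → 2 ∈ 0)
  ∧ (∀ ∀ 1 ∈ 2 + a ∧ 0 ∈ 2 + a → 1 ∈ 0 ∨ 1 ≐ 0 ∨ 0 ∈ 1)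
  ∧ (∀ zfSub 0 (S a) ∧ ¬ zfEmpty 0 →
       ∃ 0 ∈ 1 ∧ (∀ 0 ∈ 2 → 1 ∈ 0 ∨ 1 ≐ 0)).
Definition zfLim (a : nat) : zf :=
  zfOrd a ∧ ¬ zfEmpty a ∧ ¬ (∃ zfSucc (S a) 0).

(** ** The axioms of ZFC *)

Definition zfc_extensionality : zf :=
  ∀ ∀ (∀ 0 ∈ 2 ↔ 0 ∈ 1) → 1 ≐ 0.
Definition zfc_foundation : zf :=
  ∀ (∃ 0 ∈ 1) → ∃ 0 ∈ 1 ∧ ¬ (∃ 0 ∈ 2 ∧ 0 ∈ 1).
Definition zfc_pairing : zf := ∀ ∀ ∃ zfUPair 0 2 1.
Definition zfc_union : zf := ∀ ∃ ∀ 0 ∈ 1 ↔ (∃ 1 ∈ 0 ∧ 0 ∈ 3).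
Definition zfc_power : zf := ∀ ∃ ∀ 0 ∈ 1 ↔ zfSub 0 2.
Definition zfc_infinity : zf :=
  ∃ (∃ zfEmpty 0 ∧ 0 ∈ 1) ∧ (∀ 0 ∈ 1 → ∃ zfSucc 0 1 ∧ 0 ∈ 2).
Definition zfc_separation (φ : zf) : zf :=
  ∀ ∃ ∀ 0 ∈ 1 ↔ (0 ∈ 2 ∧ zf_ren (at1 0 2) φ).
Definition zfc_replacement (φ : zf) : zf :=
  (∀ ∀ ∀ zf_ren (at2 2 1 3) φ ∧ zf_ren (at2 2 0 3) φ → 1 ≐ 0) →
  ∀ ∃ ∀ 0 ∈ 1 ↔ (∃ 0 ∈ 3 ∧ zf_ren (at2 0 1 4) φ).
Definition zfc_choice : zf :=
  ∀ (∀ 0 ∈ 1 → ∃ 0 ∈ 1) →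
    ∃ zfFun 0 1 ∧ (∀ 0 ∈ 2 → ∃ zfApp 2 1 0 ∧ 0 ∈ 1).

End SetVocabulary.

Inductive ZFC : zf -> Prop :=
| ZFC_extensionality : ZFC zfc_extensionality
| ZFC_foundation : ZFC zfc_foundation
| ZFC_pairing : ZFC zfc_pairing
| ZFC_union : ZFC zfc_union
| ZFC_power : ZFC zfc_power
| ZFC_infinity : ZFC zfc_infinity
| ZFC_choice : ZFC zfc_choice
| ZFC_separation n φ :
    zf_closed 0 (zf_gen n (zfc_separation φ)) ->
    ZFC (zf_gen n (zfc_separation φ))
| ZFC_replacement n φ :
    zf_closed 0 (zf_gen n (zfc_replacement φ)) ->
    ZFC (zf_gen n (zfc_replacement φ)).

(** * The logic BS4 in the language of set theory *)

Inductive bs4 : Type :=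
| bIn  (x y : nat)
| bEq  (x y : nat)
| bBot
| bNeg (φ : bs4)
| bAnd (φ ψ : bs4)
| bOr  (φ ψ : bs4)
| bImp (φ ψ : bs4)
| bAll (φ : bs4)
| bEx  (φ : bs4).

Fixpoint b_ren (r : nat -> nat) (φ : bs4) : bs4 :=
  match φ with
  | bIn x y => bIn (r x) (r y)
  | bEq x y => bEq (r x) (r y)
  | bBot => bBot
  | bNeg φ => bNeg (b_ren r φ)
  | bAnd φ ψ => bAnd (b_ren r φ) (b_ren r ψ)
  | bOr φ ψ => bOr (b_ren r φ) (b_ren r ψ)
  | bImp φ ψ => bImp (b_ren r φ) (b_ren r ψ)
  | bAll φ => bAll (b_ren (up r) φ)
  | bEx φ => bEx (b_ren (up r) φ)
  end.

Fixpoint b_closed (n : nat) (φ : bs4) : Prop :=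
  match φ with
  | bIn x y | bEq x y => x < n /\ y < n
  | bBot => True
  | bNeg φ => b_closed n φ
  | bAnd φ ψ | bOr φ ψ | bImp φ ψ => b_closed n φ /\ b_closed n ψ
  | bAll φ | bEx φ => b_closed (S n) φ
  end.

Fixpoint b_gen (n : nat) (φ : bs4) : bs4 :=
  match n with 0 => φ | S n => bAll (b_gen n φ) end.

Definition bIff (φ ψ : bs4) : bs4 := bAnd (bImp φ ψ) (bImp ψ φ).
Definition bSImp (φ ψ : bs4) : bs4 :=
  bAnd (bImp φ ψ) (bImp (bNeg ψ) (bNeg φ)).
Definition bSIff (φ ψ : bs4) : bs4 :=
  bAnd (bIff φ ψ) (bIff (bNeg φ) (bNeg ψ)).
Definition bNot (φ : bs4) : bs4 := bImp φ bBot.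
Definition bBang (φ : bs4) : bs4 := bNeg (bNot φ).
Definition bQuest (φ : bs4) : bs4 := bNot (bNeg φ).
Definition bCirc (φ : bs4) : bs4 := bIff (bBang φ) (bQuest φ).

Declare Scope bs4_scope.
Delimit Scope bs4_scope with bs4.
Bind Scope bs4_scope with bs4.
Notation "x ∈ y" := (bIn x y) (at level 70, no associativity) : bs4_scope.
Notation "x ≐ y" := (bEq x y) (at level 70, no associativity) : bs4_scope.
Notation "∼ φ" := (bNeg φ) (at level 75, right associativity) : bs4_scope.
Notation "! φ" := (bBang φ) (at level 75, right associativity) : bs4_scope.
Notation "? φ" := (bQuest φ) (at level 75, right associativity) : bs4_scope.
Notation "∘ φ" := (bCirc φ) (at level 75, right associativity) : bs4_scope.
Notation "φ ∧ ψ" := (bAnd φ ψ) (at level 80, right associativity) : bs4_scope.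
Notation "φ ∨ ψ" := (bOr φ ψ) (at level 85, right associativity) : bs4_scope.
Notation "φ → ψ" := (bImp φ ψ) (at level 90, right associativity) : bs4_scope.
Notation "φ ⇒ ψ" := (bSImp φ ψ) (at level 90, right associativity) : bs4_scope.
Notation "φ ↔ ψ" := (bIff φ ψ) (at level 95, no associativity) : bs4_scope.
Notation "φ ⇔ ψ" := (bSIff φ ψ) (at level 95, no associativity) : bs4_scope.
Notation "∀ φ" := (bAll φ) (at level 200, right associativity) : bs4_scope.
Notation "∃ φ" := (bEx φ) (at level 200, right associativity) : bs4_scope.

(** ** Set-theoretic vocabulary

    Class terms are eliminated contextually: [y ∈ {z : φ(z)}] is [φ(y)], and
    a class term [τ] in another argument position is replaced by a bound
    variable [t] subject to the classical condition [!(t = τ)].  Accordingly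
    [{τ(x) : φ(x)}] is [{z : ∃x (!(z = τ(x)) ∧ φ(x))}]. *)

Section BS4Vocabulary.
Local Open Scope bs4_scope.

(* x = {y : φ(y)}; inside φ, y is variable 0 *)
Definition bIsClass (x : nat) (φ : bs4) : bs4 := ∀ 0 ∈ S x ⇔ φ.
(* {z : φ(z)} ⊆ {z : ψ(z)}; inside φ and ψ, z is variable 0 *)
Definition bClassSub (φ ψ : bs4) : bs4 := ∀ φ ⇒ ψ.
Definition bSub (x y : nat) : bs4 := bClassSub (0 ∈ S x) (0 ∈ S y).
(* x is a classical set *)
Definition bClassical (x : nat) : bs4 := ∀ !(0 ∈ S x) ↔ ?(0 ∈ S x).

Definition bIsEmpty (x : nat) : bs4 := bIsClass x bBot.
Definition bIsSing (s u : nat) : bs4 := bIsClass s (!(0 ≐ S u)).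
Definition bIsUPair (s u v : nat) : bs4 :=
  bIsClass s (!(0 ≐ S u) ∨ !(0 ≐ S v)).
(* s = y ∪ {y} *)
Definition bIsSucc (s y : nat) : bs4 :=
  bIsClass s (0 ∈ S y ∨ !(0 ≐ S y)).
(* p = ⟨u, v⟩ = {{u}, {u, v}} *)
Definition bIsKPair (p u v : nat) : bs4 :=
  ∃ ∃ !(bIsSing 1 (2 + u)) ∧ !(bIsUPair 0 (2 + u) (2 + v))
      ∧ bIsUPair (2 + p) 1 0.
(* z = ⟨x, ∅⟩ *)
Definition bIsTag0 (z x : nat) : bs4 :=
  ∃ !(bIsEmpty 0) ∧ bIsKPair (S z) (S x) 0.
(* z = ⟨y, {∅}⟩ *)
Definition bIsTag1 (z y : nat) : bs4 :=
  ∃ ∃ !(bIsEmpty 1) ∧ !(bIsSing 0 1) ∧ bIsKPair (2 + z) (2 + y) 0.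
(* z ∈ {⟨x, ∅⟩ : x ∈ aᵐ} ∪ {⟨y, {∅}⟩ : y ∈ bᵐ}, where the modality m is
   ! or ? *)
Definition bInDisjUnion (m : bs4 -> bs4) (z a b : nat) : bs4 :=
  (∃ !(bIsTag0 (S z) 0) ∧ m (0 ∈ S a)) ∨ (∃ !(bIsTag1 (S z) 0) ∧ m (0 ∈ S b)).
(* p = (a, b): p^! and p^? are the disjoint unions of a^!, b^! and a^?, b^? *)
Definition bIsPair (p a b : nat) : bs4 :=
  (∀ !(0 ∈ S p) ⇔ bInDisjUnion bBang 0 (S a) (S b))
  ∧ (∀ ?(0 ∈ S p) ⇔ bInDisjUnion bQuest 0 (S a) (S b)).
(* (x, y) ∈ r *)
Definition bPairIn (x y r : nat) : bs4 :=
  ∃ !(bIsPair 0 (S x) (S y)) ∧ 0 ∈ S r.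
(* z ∈ a × b *)
Definition bInProd (z a b : nat) : bs4 :=
  ∃ ∃ !(bIsPair (2 + z) 1 0) ∧ (1 ∈ 2 + a ∧ 0 ∈ 2 + b).
(* a = dom(r) *)
Definition bIsDom (a r : nat) : bs4 := bIsClass a (∃ bPairIn 1 0 (2 + r)).
(* f is a classical function from a to b *)
Definition bIsFun (f a b : nat) : bs4 :=
  bClassical f
  ∧ bClassSub (0 ∈ S f) (bInProd 0 (S a) (S b))
  ∧ bIsDom a f
  ∧ (∀ ∀ ∀ bPairIn 2 1 (3 + f) ∧ bPairIn 2 0 (3 + f) → !(1 ≐ 0)).

(** ** The axioms of BZFC *)

Definition bz_extensionality : bs4 :=
  ∀ ∀ 1 ≐ 0 ⇔ (∀ 0 ∈ 2 ⇔ 0 ∈ 1).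
Definition bz_comprehension (φ : bs4) : bs4 :=
  ∀ ∃ ∀ 0 ∈ 1 ⇔ (0 ∈ 2 ∧ b_ren (at1 0 2) φ).
Definition bz_classical_superset : bs4 :=
  ∀ ∃ bSub 1 0 ∧ (∀ ∘(0 ∈ 1)).
Definition bz_replacement (φ : bs4) : bs4 :=
  (∀ ∀ ∘(b_ren (at2 1 0 2) φ))
  ∧ (∀ ∃ b_ren (at2 1 0 2) φ ∧ (∀ b_ren (at2 2 0 3) φ → !(1 ≐ 0)))
  → ∀ ∃ ∀ 0 ∈ 1 ⇔ (∃ 0 ∈ 3 ∧ b_ren (at2 0 1 4) φ).
Definition bz_pairing : bs4 :=
  ∀ ∀ ∃ ∀ 0 ∈ 1 ⇔ (!(0 ≐ 3) ∨ !(0 ≐ 2)).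
Definition bz_power : bs4 := ∀ ∃ ∀ 0 ∈ 1 ⇔ !(bSub 0 2).
Definition bz_union : bs4 := ∀ ∃ ∀ 0 ∈ 1 ⇔ (∃ 1 ∈ 0 ∧ 0 ∈ 3).
Definition bz_infinity : bs4 :=
  ∃ (∃ !(bIsEmpty 0) ∧ 0 ∈ 1) ∧ (∀ 0 ∈ 1 → ∃ !(bIsSucc 0 1) ∧ 0 ∈ 2).
Definition bz_foundation (φ : bs4) : bs4 :=
  (∀ (∀ !(0 ∈ 1) ∨ ?(0 ∈ 1) → b_ren (at1 0 2) φ) → b_ren (at1 0 1) φ)
  → ∀ b_ren (at1 0 1) φ.
Definition bz_choice : bs4 :=
  ∀ bClassical 0 ∧ (∀ 0 ∈ 1 → ∃ 0 ∈ 1) →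
    ∃ (∃ bIsFun 1 2 0) ∧ (∀ 0 ∈ 2 → ∃ bPairIn 1 0 2 ∧ 0 ∈ 1).
(* ∃x (x^! ⊈ x^?) ∧ ∃x (x^? ⊈ x^!) *)
Definition bz_acla : bs4 :=
  (∃ ∼ bClassSub (!(0 ∈ 1)) (?(0 ∈ 1)))
  ∧ (∃ ∼ bClassSub (?(0 ∈ 1)) (!(0 ∈ 1))).

End BS4Vocabulary.

Inductive PZFC : bs4 -> Prop :=
| PZFC_extensionality : PZFC bz_extensionality
| PZFC_classical_superset : PZFC bz_classical_superset
| PZFC_pairing : PZFC bz_pairing
| PZFC_power : PZFC bz_power
| PZFC_union : PZFC bz_union
| PZFC_infinity : PZFC bz_infinity
| PZFC_choice : PZFC bz_choice
| PZFC_comprehension n φ :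
    b_closed 0 (b_gen n (bz_comprehension φ)) ->
    PZFC (b_gen n (bz_comprehension φ))
| PZFC_replacement n φ :
    b_closed 0 (b_gen n (bz_replacement φ)) ->
    PZFC (b_gen n (bz_replacement φ))
| PZFC_foundation n φ :
    b_closed 0 (b_gen n (bz_foundation φ)) ->
    PZFC (b_gen n (bz_foundation φ)).

Inductive BZFC : bs4 -> Prop :=
| BZFC_PZFC φ : PZFC φ -> BZFC φ
| BZFC_ACLA : BZFC bz_acla.

(** * The class W as a formula of ZFC *)

Section ClassW.
Local Open Scope zf_scope.

(* q = P(w) × P(w) *)
Definition wIsStep (q w : nat) : zf :=
  ∀ 0 ∈ S q ↔ (∃ ∃ zfPair 2 1 0 ∧ zfSub 1 (3 + w) ∧ zfSub 0 (3 + w)).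
(* f obeys the recursion defining W_β at every β in its domain *)
Definition wIsRec (f : nat) : zf :=
  ∀ ∀ zfApp (2 + f) 1 0 →
    (zfEmpty 1 → zfEmpty 0)
    ∧ (∀ ∀ zfSucc 3 1 → zfApp (4 + f) 1 0 → wIsStep 2 0)
    ∧ (zfLim 1 →
       ∀ 0 ∈ 1 ↔ (∃ ∃ 1 ∈ 4 ∧ zfApp (5 + f) 1 0 ∧ 2 ∈ 0)).
(* w = W_a: some f with domain a + 1 obeys the recursion and f(a) = w *)
Definition wIsLevel (w a : nat) : zf :=
  ∃ ∃ zfSucc 0 (2 + a) ∧ zfFun 1 0 ∧ wIsRec 1 ∧ zfApp 1 (2 + a) (2 + w).
Definition inW (x : nat) : zf :=
  ∃ ∃ zfOrd 1 ∧ wIsLevel 0 1 ∧ 2 + x ∈ 0.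

(* the four relations of the T/F-model on W; below, x = (a, b), y = (c, d) *)
Definition wInT (x y : nat) : zf :=
  ∃ ∃ zfPair (2 + y) 1 0 ∧ 2 + x ∈ 1.
Definition wInF (x y : nat) : zf :=
  ∃ ∃ zfPair (2 + y) 1 0 ∧ ¬ 2 + x ∈ 0.
Definition wEqT (x y : nat) : zf := x ≐ y.
Definition wEqF (x y : nat) : zf :=
  ∃ ∃ ∃ ∃ zfPair (4 + x) 3 2 ∧ zfPair (4 + y) 1 0
          ∧ ((∃ 0 ∈ 4 ∧ ¬ 0 ∈ 1) ∨ (∃ 0 ∈ 2 ∧ ¬ 0 ∈ 3)).

(** [trT φ] and [trF φ] are φ^{W,T} and φ^{W,F}. *)
Fixpoint trT (φ : bs4) : zf :=
  match φ with
  | bIn x y => wInT x y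
  | bEq x y => wEqT x y
  | bBot => zfBot
  | bNeg φ => trF φ
  | bAnd φ ψ => trT φ ∧ trT ψ
  | bOr φ ψ => trT φ ∨ trT ψ
  | bImp φ ψ => trT φ → trT ψ
  | bAll φ => ∀ inW 0 → trT φ
  | bEx φ => ∃ inW 0 ∧ trT φ
  end
with trF (φ : bs4) : zf :=
  match φ with
  | bIn x y => wInF x y
  | bEq x y => wEqF x y
  | bBot => ¬ zfBot
  | bNeg φ => trT φ
  | bAnd φ ψ => trF φ ∨ trF ψ
  | bOr φ ψ => trF φ ∧ trF ψ
  | bImp φ ψ => trT φ ∧ trF ψ
  | bAll φ => ∃ inW 0 ∧ trF φ
  | bEx φ => ∀ inW 0 → trF φ
  end.

End ClassW.

Definition W_models (Γ : bs4 -> Prop) : Prop :=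
  forall φ, Γ φ -> proves ZFC (trT φ).

(* Main.v *)
(** By the completeness theorem for natural deduction it suffices to show that
    φ^{W,T} holds in every Tarskian model M of ZFC, for each axiom φ of BZFC.
    Inside M, well-founded arguments are available for definable predicates only,
    so definability with parameters is tracked throughout.  The key fact about the
    hierarchy is that x ∈ W iff x = (a, b) for some sets a, b of elements of W.
    Hence an element of W is nothing but a pair of small classes of elements of W,
    its positive extension and the complement of its negative extension, and every
    existence axiom of BZFC follows by forming the two components separately. *)

From Stdlib Require Import List Arith Lia Classical ClassicalEpsilon
  FunctionalExtensionality PropExtensionality ProofIrrelevance Cantor.
Require Import Defs.
Import ListNotations.

(** Working in models replaces formal derivations by ordinary reasoning about a type [W] of elements
    of [M]. The price is that [M] is arbitrary: its membership may be ill-founded from outside, and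
    a Rocq predicate may enter Separation or Replacement only together with a defining formula. The
    translation supplies these formulas for BS4, since [trT φ] and [trF φ] define truth and falsity
    of [φ] in W. The negative extension of an element of W is a proper class, so falsity is always
    treated through its complement: [y ∈ x ⇔ φ(y)] asks that the [y] where [φ] is true form a set,
    and that the [y] where [φ] is not false form a set. These are two independent requirements
    unless something classical links them. In Replacement, classicality of [φ] lets one functional
    graph move both components; in Choice, classicality of the family matches the domain of a crisp
    function with it. Formulas under [!] are two-valued, and the sets they describe have equal
    components. *)

Lemma or_eq {A} (u v u' v' : A) :
  (forall z, z = u \/ z = v <-> z = u' \/ z = v') -> (u = u' /\ v = v') \/ (u = v' /\ v = u').
Proof.
  intro H.
  pose proof (proj1 (H u) (or_introl eq_refl)).
  pose proof (proj1 (H v) (or_intror eq_refl)).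
  pose proof (proj2 (H u') (or_introl eq_refl)).
  pose proof (proj2 (H v') (or_intror eq_refl)).
  intuition congruence.
Qed.

Lemma NNPP_iff P : ~ ~ P <-> P.
Proof. split; [apply NNPP|tauto]. Qed.

Definition scons {A} (x : A) (ρ : nat -> A) (k : nat) : A :=
  match k with 0 => x | S k => ρ k end.
Notation "x .: ρ" := (scons x ρ) (at level 55, right associativity).

(** * Renaming *)

Lemma up_ext r s : (forall k, r k = s k) -> forall k, up r k = up s k.
Proof. intros H [|k]; cbn; [|rewrite H]; reflexivity. Qed.

Lemma zf_ren_ext φ : forall r s, (forall k, r k = s k) -> zf_ren r φ = zf_ren s φ.
Proof.
  induction φ; intros r s H; cbn; rewrite ?H; f_equal; eauto using up_ext.
Qed.

Lemma up_comp r s k : up r (up s k) = up (fun k => r (s k)) k.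
Proof. destruct k; reflexivity. Qed.

Lemma zf_ren_comp φ : forall r s,
  zf_ren r (zf_ren s φ) = zf_ren (fun k => r (s k)) φ.
Proof.
  induction φ; intros r s; cbn; f_equal; auto;
    rewrite IHφ; apply zf_ren_ext; intros; apply up_comp.
Qed.

Lemma zf_ren_closed φ : forall n r,
  zf_closed n φ -> (forall k, k < n -> r k = k) -> zf_ren r φ = φ.
Proof.
  induction φ; cbn; intros n r Hc H; f_equal;
    try (apply H; tauto); try (apply (IHφ1 n r); tauto); try (apply (IHφ2 n r); tauto);
    try reflexivity;
    (apply (IHφ (S n)); [assumption|]; intros [|k] Hk; cbn; [|rewrite H]; auto with arith).
Qed.

Lemma zf_ren_id φ : zf_ren (fun k => k) φ = φ.
Proof.
  induction φ; cbn; f_equal; auto; etransitivity; try eassumption;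
    apply zf_ren_ext; intros [|k]; reflexivity.
Qed.

Lemma zf_closed_mono φ : forall m n, zf_closed m φ -> m <= n -> zf_closed n φ.
Proof.
  induction φ; cbn; intros m n Hc H; try tauto; try lia;
    try (destruct Hc; eauto); eapply IHφ; eauto; lia.
Qed.

(** A crude bound, not lowered under binders. It serves to close schema instances, which ZFC
    contains only as closed generalizations [zf_gen n]. *)
Fixpoint zf_bound (φ : zf) : nat :=
  match φ with
  | zfIn x y | zfEq x y => S (x + y)
  | zfBot => 0
  | zfAnd φ ψ | zfOr φ ψ | zfImp φ ψ => zf_bound φ + zf_bound ψ
  | zfAll φ | zfEx φ => zf_bound φ
  end.

Lemma zf_bound_closed φ : zf_closed (zf_bound φ) φ.
Proof.
  induction φ; cbn; try lia; auto;
    try (split; eapply zf_closed_mono; eauto; lia);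
    eapply zf_closed_mono; eauto; lia.
Qed.

Lemma zf_closed_gen n : forall m φ, zf_closed (n + m) φ -> zf_closed m (zf_gen n φ).
Proof.
  induction n; cbn; intros m φ H; auto.
  apply IHn. rewrite Nat.add_succ_r. exact H.
Qed.

(** * Renaming and weakening of derivations *)

Lemma zf_ren_inst r t φ : zf_ren r (zf_inst t φ) = zf_inst (r t) (zf_ren (up r) φ).
Proof.
  unfold zf_inst. rewrite !zf_ren_comp. apply zf_ren_ext.
  intros [|k]; cbn; [|rewrite !Nat.add_0_r]; reflexivity.
Qed.

Lemma map_ren_up r Γ :
  map (zf_ren S) (map (zf_ren r) Γ) = map (zf_ren (up r)) (map (zf_ren S) Γ).
Proof.
  rewrite !map_map. apply map_ext. intro φ. rewrite !zf_ren_comp. reflexivity.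
Qed.

(** Holds for arbitrary, even non-injective, renamings: the eigenvariable is always index 0, and
    [up] keeps it apart from the rest. It is what turns a Henkin witness into an eigenvariable. *)
Lemma nd_ren Γ φ : nd Γ φ -> forall r, nd (map (zf_ren r) Γ) (zf_ren r φ).
Proof.
  induction 1; intro r; cbn in *.
  - apply nd_hyp, in_map; assumption.
  - apply nd_dne, IHnd.
  - apply nd_botE, IHnd.
  - apply nd_andI; auto.
  - eapply nd_andE1, IHnd.
  - eapply nd_andE2, IHnd.
  - apply nd_orI1; auto.
  - apply nd_orI2; auto.
  - eapply nd_orE; eauto.
  - apply nd_impI, IHnd.
  - eapply nd_impE; eauto.
  - apply nd_allI. rewrite map_ren_up. apply IHnd.
  - rewrite zf_ren_inst. apply nd_allE, IHnd.
  - eapply nd_exI. rewrite <- zf_ren_inst. apply IHnd.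
  - eapply nd_exE; [apply IHnd1|]. rewrite map_ren_up.
    specialize (IHnd2 (up r)). rewrite zf_ren_comp in *. apply IHnd2.
  - apply nd_eqI.
  - rewrite zf_ren_inst in *. eapply nd_eqE; [apply IHnd1|].
    specialize (IHnd2 r). rewrite zf_ren_inst in IHnd2. apply IHnd2.
Qed.

Lemma nd_weak Γ φ : nd Γ φ -> forall Δ, incl Γ Δ -> nd Δ φ.
Proof.
  induction 1; intros Δ HΔ.
  - apply nd_hyp; auto.
  - apply nd_dne; auto.
  - apply nd_botE; auto.
  - apply nd_andI; auto.
  - eapply nd_andE1; eauto.
  - eapply nd_andE2; eauto.
  - apply nd_orI1; auto.
  - apply nd_orI2; auto.
  - eapply nd_orE; [auto|apply IHnd2|apply IHnd3];
      intros ? [->|]; cbn; auto.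
  - apply nd_impI, IHnd. intros ? [->|]; cbn; auto.
  - eapply nd_impE; eauto.
  - apply nd_allI, IHnd, incl_map, HΔ.
  - apply nd_allE; auto.
  - eapply nd_exI; eauto.
  - eapply nd_exE; [auto|apply IHnd2].
    intros ? [->|]; [left|right; eapply incl_map]; eauto.
  - apply nd_eqI.
  - eapply nd_eqE; eauto.
Qed.

(** * Tarskian semantics *)

Fixpoint sat {M : Type} (E : M -> M -> Prop) (ρ : nat -> M) (φ : zf) : Prop :=
  match φ with
  | zfIn x y => E (ρ x) (ρ y)
  | zfEq x y => ρ x = ρ y
  | zfBot => False
  | zfAnd φ ψ => sat E ρ φ /\ sat E ρ ψ
  | zfOr φ ψ => sat E ρ φ \/ sat E ρ ψ
  | zfImp φ ψ => sat E ρ φ -> sat E ρ ψ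
  | zfAll φ => forall x, sat E (x .: ρ) φ
  | zfEx φ => exists x, sat E (x .: ρ) φ
  end.

Lemma sat_ren {M} (E : M -> M -> Prop) φ : forall r ρ σ,
  (forall k, ρ (r k) = σ k) -> sat E ρ (zf_ren r φ) <-> sat E σ φ.
Proof.
  induction φ; intros r ρ σ H; cbn; rewrite ?H; try reflexivity;
    try (rewrite (IHφ1 r ρ σ H), (IHφ2 r ρ σ H); reflexivity);
    assert (Hup : forall x k, (x .: ρ) (up r k) = (x .: σ) k)
      by (intros x [|k]; cbn; auto).
  - split; intros Hs x; apply (IHφ _ _ _ (Hup x)); auto.
  - split; intros [x Hs]; exists x; apply (IHφ _ _ _ (Hup x)); auto.
Qed.

Lemma sat_ext {M} (E : M -> M -> Prop) φ ρ σ :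
  (forall k, ρ k = σ k) -> sat E ρ φ <-> sat E σ φ.
Proof.
  intro H. rewrite <- (zf_ren_id φ) at 1. apply sat_ren. exact H.
Qed.

(** Leads from the closed generalization of a schema instance to its truth with arbitrary
    parameters. *)
Lemma sat_gen_all {M} (E : M -> M -> Prop) n : forall φ,
  (forall ρ, sat E ρ (zf_gen n φ)) -> forall ρ, sat E ρ φ.
Proof.
  induction n; cbn; intros φ H ρ; auto.
  refine (IHn φ _ ρ). intro σ.
  refine (proj1 (sat_ext E _ _ _ _) (H (fun k => σ (S k)) (σ 0))).
  intros [|k]; reflexivity.
Qed.

(** * Completeness *)

Lemma zf_enum : exists e : nat -> zf, forall φ, exists n, e n = φ.
Proof.
  set (step := fun (n : nat) (l : list zf) => l ++ zfBot ::
    flat_map (fun x => flat_map (fun y => [zfIn x y; zfEq x y]) (seq 0 n)) (seq 0 n) ++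
    flat_map (fun φ => flat_map (fun ψ => [zfAnd φ ψ; zfOr φ ψ; zfImp φ ψ]) l) l ++
    flat_map (fun φ => [zfAll φ; zfEx φ]) l).
  set (L := nat_rect (fun _ => list zf) [] step).
  assert (Hmono : forall m n φ, m <= n -> In φ (L m) -> In φ (L n)).
  { induction 1; auto. intro Hin. apply in_or_app; auto. }
  assert (HL : forall φ, exists n, In φ (L n)).
  { assert (Hat : forall x y, exists n, In (zfIn x y) (L n) /\ In (zfEq x y) (L n)).
    { intros x y. exists (S (S (x + y))).
      split; (apply in_or_app; right; right; apply in_or_app; left;
        apply in_flat_map; exists x; split; [apply in_seq; lia|];
        apply in_flat_map; exists y; split; [apply in_seq; lia|cbn; auto]). }
    assert (Hbin : forall φ ψ m n, In φ (L m) -> In ψ (L n) -> exists k,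
      In (zfAnd φ ψ) (L k) /\ In (zfOr φ ψ) (L k) /\ In (zfImp φ ψ) (L k)).
    { intros φ ψ m n Hm Hn. exists (S (m + n)).
      assert (In φ (L (m + n))) by (eapply Hmono; [|exact Hm]; lia).
      assert (In ψ (L (m + n))) by (eapply Hmono; [|exact Hn]; lia).
      split; [|split]; (apply in_or_app; right; right; apply in_or_app; right;
        apply in_or_app; left; apply in_flat_map; exists φ; split; [assumption|];
        apply in_flat_map; exists ψ; split; [assumption|cbn; auto]). }
    assert (Hq : forall φ n, In φ (L n) -> In (zfAll φ) (L (S n)) /\ In (zfEx φ) (L (S n))).
    { intros φ n Hn. split; (apply in_or_app; right; right; apply in_or_app; right;
        apply in_or_app; right; apply in_flat_map; exists φ; split; [assumption|cbn; auto]). }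
    induction φ;
      try (destruct (Hat x y) as (n & ? & ?); exists n; assumption);
      try (destruct IHφ1 as [m Hm], IHφ2 as [n Hn], (Hbin _ _ _ _ Hm Hn) as (k & ? & ? & ?);
           exists k; assumption);
      try (destruct IHφ as [n Hn]; exists (S n); apply (Hq _ _ Hn)).
    exists 1. cbn. auto. }
  (* Indices past the end of a stage yield [zfBot]; only surjectivity matters. *)
  exists (fun k => let '(n, i) := Cantor.of_nat k in nth i (L n) zfBot).
  intro φ. destruct (HL φ) as [n Hn]. destruct (In_nth _ _ zfBot Hn) as (i & _ & Hi).
  exists (Cantor.to_nat (n, i)). rewrite Cantor.cancel_of_to. exact Hi.
Qed.

Section Completeness.

Variable T : zf -> Prop.
Hypothesis T_closed : forall φ, T φ -> zf_closed 0 φ.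

(** Each stage of the Henkin construction adds finitely many formulas, kept in the list [Γ]; the
    possibly infinite [T] enters through its finite parts [Δ]. *)
Definition consistent (Γ : list zf) : Prop :=
  forall Δ, (forall ψ, In ψ Δ -> T ψ) -> ~ nd (Γ ++ Δ) zfBot.

Lemma split_hyps Γ Δ :
  (forall ψ, In ψ Δ -> T ψ \/ In ψ Γ) ->
  exists Δ', (forall ψ, In ψ Δ' -> T ψ) /\ incl Δ (Γ ++ Δ').
Proof.
  induction Δ as [|φ Δ IH]; intro H.
  - exists []. split; [intros ? []|intros ? []].
  - destruct IH as (Δ' & HT & Hi). { intros; apply H; cbn; auto. }
    destruct (H φ (or_introl eq_refl)) as [Hφ|Hφ].
    + exists (φ :: Δ'). split.
      * intros ψ [<-|]; auto.
      * intros ψ [<-|Hψ]; apply in_or_app; cbn; auto.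
        apply Hi, in_app_or in Hψ. tauto.
    + exists Δ'. split; auto. intros ψ [<-|Hψ]; auto. apply in_or_app; auto.
Qed.

(** The variable [x] plays the eigenvariable of an ∃-elimination. The axioms, although infinite in
    number, cannot contain it because they are closed. *)
Lemma consistent_witness Γ ψ x :
  consistent (zfEx ψ :: Γ) ->
  (forall φ, In φ (zfEx ψ :: Γ) -> zf_closed x φ) ->
  consistent (zf_inst x ψ :: zfEx ψ :: Γ).
Proof.
  intros Hc Hx Δ HT Hbot. apply (Hc Δ HT).
  apply (nd_exE _ ψ); [apply nd_hyp; left; reflexivity|].
  (* Moves [x] to index 0, the eigenvariable of [nd_exE], and shifts every other index. *)
  set (r := fun k => if Nat.eq_dec k x then 0 else S k).
  apply nd_ren with (r := r) in Hbot. cbn [map app zf_ren] in Hbot |- *.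
  assert (Hr : forall φ n, zf_closed n φ -> n <= x -> zf_ren r φ = zf_ren S φ).
  (* [r] and [S] differ only at [x], but [zf_ren_ext] wants agreement everywhere. Inserting a
     renaming that fixes the indices below [x] and skips [x] repairs this. *)
  { intros φ n Hn Hle. rewrite <- (zf_ren_closed φ x (fun k => if Nat.ltb k x then k else S k)) at 1.
    - rewrite zf_ren_comp.
      transitivity (zf_ren S (zf_ren (fun k => if Nat.ltb k x then k else S k) φ)).
      + rewrite zf_ren_comp. apply zf_ren_ext. intro k. unfold r.
        destruct (Nat.ltb_spec k x); destruct Nat.eq_dec; lia.
      + f_equal. apply (zf_ren_closed φ x).
        * eapply zf_closed_mono; eauto.
        * intros k Hk. destruct (Nat.ltb_spec k x); lia.
    - eapply zf_closed_mono; eauto.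
    - intros k Hk. destruct (Nat.ltb_spec k x); lia. }
  replace (zf_ren r (zf_inst x ψ)) with ψ in Hbot.
  2: { unfold zf_inst. rewrite zf_ren_comp. symmetry.
       apply (zf_ren_closed ψ (S x)).
       - apply (Hx (zfEx ψ)). left; reflexivity.
       - intros [|k] Hk; cbn; unfold r; destruct Nat.eq_dec; lia. }
  replace (map (zf_ren S) (Γ ++ Δ)) with (map (zf_ren r) (Γ ++ Δ)).
  2: { apply map_ext_in. intros φ Hφ. apply in_app_or in Hφ as [Hφ|Hφ].
       - apply (Hr _ x); auto. apply Hx; right; auto.
       - apply (Hr _ 0); auto with arith. }
  replace (zfEx (zf_ren (up S) ψ)) with (zfEx (zf_ren (up r) ψ)); auto.
  apply (Hr (zfEx ψ) x); auto. apply Hx; left; reflexivity.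
Qed.

(** A Henkin theory. The language has no constants, so variables are the witnesses. *)
Definition complete_theory (Th : zf -> Prop) : Prop :=
  (forall φ, proves Th φ -> Th φ) /\ ~ Th zfBot /\
  (forall φ, Th φ \/ Th (zfNot φ)) /\
  (forall φ, Th (zfEx φ) -> exists t, Th (zf_inst t φ)).

Definition fresh (Γ : list zf) : nat := list_sum (map zf_bound Γ).

Lemma fresh_closed Γ φ : In φ Γ -> zf_closed (fresh Γ) φ.
Proof.
  intro H. apply zf_closed_mono with (1 := zf_bound_closed φ).
  induction Γ as [|ψ Γ IH]; [destruct H|].
  change (zf_bound φ <= zf_bound ψ + fresh Γ).
  destruct H as [->|H]; [|apply IH in H]; lia.
Qed.

(* Each stage decides one formula and, when it accepts an existential one, adds a
   fresh variable as its witness. *)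
Lemma complete_extension Γ0 : consistent Γ0 ->
  exists Th, complete_theory Th /\ (forall φ, T φ -> Th φ) /\ (forall φ, In φ Γ0 -> Th φ).
Proof.
  intro Hc0. destruct zf_enum as [e He].
  set (step := fun (n : nat) (Γ : list zf) =>
    if excluded_middle_informative (consistent (e n :: Γ)) then
      match e n with
      | zfEx ψ => zf_inst (fresh (e n :: Γ)) ψ :: e n :: Γ
      | _ => e n :: Γ
      end
    else Γ).
  set (L := nat_rect (fun _ => list zf) Γ0 step).
  assert (Hcon : forall n, consistent (L n)).
  { induction n as [|n IH]; [exact Hc0|]. cbn. unfold step at 1.
    destruct excluded_middle_informative as [Hn|Hn]; [|exact IH].
    pose proof (fun φ => fresh_closed (e n :: L n) φ) as Hf. fold L.
    destruct (e n); auto. apply consistent_witness; auto. }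
  assert (Hstep : forall n φ, In φ (L n) -> In φ (L (S n))).
  { intros n φ H. cbn. unfold step at 1. fold L.
    destruct excluded_middle_informative; auto. destruct (e n); cbn; auto. }
  assert (Hmono : forall m n φ, m <= n -> In φ (L m) -> In φ (L n)).
  { induction 1; auto. }
  set (Th := fun φ => exists n, T φ \/ In φ (L n)).
  assert (Hfin : forall Δ, (forall ψ, In ψ Δ -> Th ψ) ->
    exists n, forall ψ, In ψ Δ -> T ψ \/ In ψ (L n)).
  { induction Δ as [|φ Δ IH]; intro H.
    - exists 0. intros ? [].
    - destruct IH as [m Hm]. { intros; apply H; cbn; auto. }
      destruct (H φ (or_introl eq_refl)) as [n Hn]. exists (m + n).
      intros ψ [<-|Hψ]; [destruct Hn as [|Hi]|destruct (Hm _ Hψ) as [|Hi]]; auto;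
        right; (eapply Hmono; [|exact Hi]; lia). }
  assert (HThcon : ~ proves Th zfBot).
  { intros (Δ & HΔ & Hbot). destruct (Hfin _ HΔ) as [n Hn].
    destruct (split_hyps _ _ Hn) as (Δ' & HT & Hi).
    apply (Hcon n Δ' HT). eapply nd_weak; eauto. }
  (* Each formula is treated at some stage; if rejected there, finitely many members of [Th] refute
     it. Completeness and deductive closure both follow from this. *)
  assert (Hdec : forall φ, Th φ \/ exists Δ, (forall ψ, In ψ Δ -> Th ψ) /\ nd (φ :: Δ) zfBot).
  { intro φ. destruct (He φ) as [n Hn].
    destruct (classic (consistent (φ :: L n))) as [Hφ|Hφ].
    - left. exists (S n). right. cbn. unfold step at 1. fold L. rewrite Hn.
      destruct excluded_middle_informative; [|contradiction]. destruct φ; cbn; auto.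
    - right. apply not_all_ex_not in Hφ as [Δ Hφ]. apply imply_to_and in Hφ as [HT Hb].
      exists (L n ++ Δ). split; [|apply NNPP, Hb].
      intros ψ H. apply in_app_or in H as [H|H]; [exists n; auto|exists 0; auto]. }
  assert (Hded : forall φ, proves Th φ -> Th φ).
  { intros φ (Δ & HΔ & H). destruct (Hdec φ) as [|(Δ' & HΔ' & H')]; auto.
    exfalso. apply HThcon. exists (Δ ++ Δ'). split.
    - intros ψ Hψ. apply in_app_or in Hψ as []; auto.
    - apply (nd_impE _ φ); [apply nd_impI|]; eapply nd_weak; eauto.
      + intros ? [->|]; cbn; auto using in_or_app.
      + auto using incl_appl, incl_refl. }
  exists Th. split; [split; [|split; [|split]]|split].
  - exact Hded.
  - intro H. apply HThcon. exists [zfBot]. split; [intros ? [<-|[]]; auto|].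
    apply nd_hyp; left; reflexivity.
  - intro φ. destruct (Hdec φ) as [|(Δ & HΔ & H)]; auto.
    right. apply Hded. exists Δ. split; auto. apply nd_impI; auto.
  - intros φ Hφ. destruct (He (zfEx φ)) as [n Hn].
    exists (fresh (e n :: L n)). exists (S n). right. cbn. unfold step at 1. fold L.
    (* Rejection at its own stage would make [zfEx φ] inconsistent with [Th], so the stage did add
       the witness. *)
    destruct excluded_middle_informative as [Hi|Hi].
    + rewrite Hn. cbn; auto.
    + exfalso. apply not_all_ex_not in Hi as [Δ Hi]. apply imply_to_and in Hi as [HT Hb].
      apply NNPP in Hb. rewrite Hn in Hb. apply HThcon. exists (zfEx φ :: L n ++ Δ).
      split; auto. intros ψ [<-|H]; auto.
      apply in_app_or in H as [H|H]; [exists n|exists 0]; auto.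
  - intros φ H. exists 0; auto.
  - intros φ H. exists 0; auto.
Qed.

(** * The term model of a Henkin theory *)

Section TermModel.

Variable Th : zf -> Prop.
Hypothesis HTh : complete_theory Th.

Lemma Th_nd Γ φ : (forall ψ, In ψ Γ -> Th ψ) -> nd Γ φ -> Th φ.
Proof. intros H Hn. apply HTh. exists Γ; auto. Qed.

(** Shaped so that a bare rule of the calculus, such as [nd_andE1], is the whole argument. *)
Lemma Th_hyp1 φ ψ : (nd [φ] φ -> nd [φ] ψ) -> Th φ -> Th ψ.
Proof.
  intros H Hφ. apply (Th_nd [φ]); [intros ? [<-|[]]; auto|].
  apply H, nd_hyp; left; reflexivity.
Qed.

Lemma Th_hyp2 φ ψ χ : (nd [φ; ψ] φ -> nd [φ; ψ] ψ -> nd [φ; ψ] χ) -> Th φ -> Th ψ -> Th χ.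
Proof.
  intros H Hφ Hψ. apply (Th_nd [φ; ψ]); [intros ? [<-|[<-|[]]]; auto|].
  apply H; apply nd_hyp; cbn; auto.
Qed.

Lemma Th_not φ : Th (zfNot φ) <-> ~ Th φ.
Proof.
  destruct HTh as (_ & Hb & Hd & _). split.
  - intros Hn Hφ. apply Hb. revert Hn Hφ. apply Th_hyp2. apply nd_impE.
  - intro H. destruct (Hd φ); tauto.
Qed.

Lemma Th_inst_eq s t φ : Th (zfEq s t) -> Th (zf_inst s φ) -> Th (zf_inst t φ).
Proof. apply Th_hyp2. apply nd_eqE. Qed.

Lemma Th_eq_refl t : Th (zfEq t t).
Proof. apply (Th_nd []); [intros ? []|apply nd_eqI]. Qed.

Lemma Th_eq_sym s t : Th (zfEq s t) -> Th (zfEq t s).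
Proof.
  (* Leibniz substitution in a template: index 0 is the hole, and [S s] is [s] as seen below it. *)
  intro H. generalize (Th_inst_eq s t (zfEq 0 (S s)) H). cbn.
  rewrite Nat.add_0_r. auto using Th_eq_refl.
Qed.

Lemma Th_eq_trans s t u : Th (zfEq s t) -> Th (zfEq t u) -> Th (zfEq s u).
Proof.
  intros H1 H2. generalize (Th_inst_eq t u (zfEq (S s) 0) H2). cbn.
  rewrite Nat.add_0_r. auto.
Qed.

(** [sat] reads equality as Rocq equality, so variables must be divided by provable equality.
    Applying [epsilon] to the class itself gives canonical representatives: classes that are equal
    by extensionality receive the same choice. *)
Definition rep (n : nat) : nat := epsilon (inhabits 0) (fun m => Th (zfEq n m)).

Lemma rep_eq n : Th (zfEq n (rep n)).
Proof. apply (epsilon_spec (inhabits 0) (fun m => Th (zfEq n m))). exists n. apply Th_eq_refl. Qed.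

Lemma rep_iff m n : rep m = rep n <-> Th (zfEq m n).
Proof.
  split; intro H.
  - apply (Th_eq_trans _ (rep m)); [apply rep_eq|]. rewrite H. apply Th_eq_sym, rep_eq.
  - unfold rep. f_equal. extensionality k. apply propositional_extensionality.
    split; eauto using Th_eq_trans, Th_eq_sym.
Qed.

Definition term_model : Type := {n : nat | rep n = n}.
Definition term_mem (a b : term_model) : Prop := Th (zfIn (proj1_sig a) (proj1_sig b)).

Definition cls (n : nat) : term_model :=
  exist _ (rep n) (proj2 (rep_iff _ _) (Th_eq_sym _ _ (rep_eq n))).

Lemma cls_iff m n : cls m = cls n <-> Th (zfEq m n).
Proof.
  rewrite <- rep_iff. split; [intros [=]; auto|].
  intro H. apply subset_eq_compat. exact H.
Qed.

Lemma cls_surj a : exists n, a = cls n.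
Proof. destruct a as [n Hn]. exists n. apply subset_eq_compat. auto. Qed.

Lemma cls_mem m n : term_mem (cls m) (cls n) <-> Th (zfIn m n).
Proof.
  assert (H : forall a b c d, Th (zfEq a c) -> Th (zfEq b d) ->
    Th (zfIn a b) -> Th (zfIn c d)).
  { intros a b c d H1 H2 H3. generalize (Th_inst_eq a c (zfIn 0 (S b)) H1).
    generalize (Th_inst_eq b d (zfIn (S c) 0) H2). cbn.
    rewrite !Nat.add_0_r. auto. }
  unfold term_mem; cbn. split; apply H; auto using rep_eq, Th_eq_sym.
Qed.

(** Generalized over [σ] so that the induction passes binders: every element of the term model is
    some [cls n], and choosing it amounts to renaming by [n .: σ]. *)
Lemma truth φ : forall σ,
  sat term_mem (fun k => cls (σ k)) φ <-> Th (zf_ren σ φ).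
Proof.
  assert (Hinst : forall σ n ψ, zf_ren (n .: σ) ψ = zf_inst n (zf_ren (up σ) ψ)).
  { intros σ n ψ. unfold zf_inst. rewrite zf_ren_comp. apply zf_ren_ext.
    intros [|k]; cbn; [|rewrite Nat.add_0_r]; reflexivity. }
  assert (Hsat : forall σ n ψ, sat term_mem (cls n .: fun k => cls (σ k)) ψ <->
    sat term_mem (fun k => cls ((n .: σ) k)) ψ).
  { intros σ n ψ. apply sat_ext. intros [|k]; reflexivity. }
  induction φ; intro σ; cbn.
  - apply cls_mem.
  - apply cls_iff.
  - destruct HTh as (_ & Hb & _). tauto.
  - rewrite IHφ1, IHφ2. split.
    + intros [H1 H2]. revert H1 H2. apply Th_hyp2. apply nd_andI.
    + intro H. split; revert H; apply Th_hyp1; [apply nd_andE1|apply nd_andE2].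
  - rewrite IHφ1, IHφ2. split.
    + intros [H|H]; revert H; apply Th_hyp1; [apply nd_orI1|apply nd_orI2].
    + intro H. apply NNPP. intro Hn. apply not_or_and in Hn as [H1 H2].
      apply Th_not in H1, H2. destruct HTh as (_ & Hb & _). apply Hb.
      apply (Th_nd [zfOr (zf_ren σ φ1) (zf_ren σ φ2); zfNot (zf_ren σ φ1); zfNot (zf_ren σ φ2)]).
      { intros ? [<-|[<-|[<-|[]]]]; auto. }
      eapply nd_orE; [apply nd_hyp; cbn; auto| |];
        [apply (nd_impE _ (zf_ren σ φ1))|apply (nd_impE _ (zf_ren σ φ2))];
        apply nd_hyp; unfold zfNot; cbn; tauto.
  - rewrite IHφ1, IHφ2. split.
    + intro H. destruct (classic (Th (zf_ren σ φ1))) as [H1|H1].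
      * apply H in H1. revert H1. apply Th_hyp1. intro H1. apply nd_impI.
        eapply nd_weak; [exact H1|]. intros ? [->|[]]; cbn; auto.
      * apply Th_not in H1. revert H1. apply Th_hyp1. intro H1. apply nd_impI, nd_botE.
        eapply nd_impE; [|apply nd_hyp; left; reflexivity].
        eapply nd_weak; [exact H1|]. intros ? [->|[]]; cbn; auto.
    + apply Th_hyp2. apply nd_impE.
  - split.
    + intro H. apply NNPP. intro Hn. apply Th_not in Hn.
      (* Witnesses exist only for ∃, so the failure of ∀ is first turned classically into an
         existential. *)
      assert (He : Th (zfEx (zfNot (zf_ren (up σ) φ)))).
      { revert Hn. apply Th_hyp1. intro Hn. apply nd_dne, nd_impI.
        eapply nd_impE; [eapply nd_weak; [exact Hn|intros ? [->|[]]; cbn; auto]|].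
        apply nd_allI, nd_dne, nd_impI. cbn.
        eapply nd_impE; [apply nd_hyp; right; left; reflexivity|].
        apply nd_exI with (t := 0).
        replace (zf_inst _ _) with (zfNot (zf_ren (up σ) φ));
          [apply nd_hyp; left; reflexivity|].
        unfold zfNot, zf_inst; cbn. f_equal. rewrite zf_ren_comp. rewrite <- (zf_ren_id (zf_ren (up σ) φ)) at 1.
        apply zf_ren_ext. intros [|k]; cbn; auto. }
      destruct HTh as (_ & _ & _ & Hw). apply Hw in He as [t Ht].
      apply (Th_not (zf_inst t (zf_ren (up σ) φ))) in Ht. apply Ht.
      rewrite <- Hinst, <- IHφ, <- Hsat. apply H.
    + intros H x. destruct (cls_surj x) as [n ->]. rewrite Hsat, IHφ, Hinst.
      revert H. apply Th_hyp1. apply nd_allE.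
  - split.
    + intros [x H]. destruct (cls_surj x) as [n ->]. rewrite Hsat, IHφ, Hinst in H.
      revert H. apply Th_hyp1. apply nd_exI.
    + intro H. destruct HTh as (_ & _ & _ & Hw). apply Hw in H as [t Ht].
      exists (cls t). rewrite Hsat, IHφ, Hinst. exact Ht.
Qed.

End TermModel.

Theorem completeness φ :
  (forall (M : Type) (E : M -> M -> Prop) (ρ : nat -> M),
     (forall ψ σ, T ψ -> sat E σ ψ) -> sat E ρ φ) ->
  proves T φ.
Proof.
  intro H. apply NNPP. intro Hn.
  assert (Hc : consistent [zfNot φ]).
  { intros Δ HT Hb. apply Hn. exists Δ. split; auto. apply nd_dne, nd_impI, Hb. }
  destruct (complete_extension _ Hc) as (Th & HTh & HT & Hφ).
  specialize (Hφ _ (or_introl eq_refl)).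
  apply (Th_not Th HTh) in Hφ. apply Hφ.
  rewrite <- (zf_ren_id φ). rewrite <- (truth Th HTh φ (fun k => k)). apply H.
  intros ψ σ Hψ.
  (* An arbitrary assignment into the term model is lifted to variables; the resulting renaming
     fixes [ψ] because axioms are closed. *)
  destruct (choice (fun a n => a = cls Th HTh n) (cls_surj Th HTh)) as [g Hg].
  apply (sat_ext _ _ _ (fun k => cls Th HTh (g (σ k)))); [intro; apply Hg|].
  apply truth. rewrite (zf_ren_closed ψ 0); auto. lia.
Qed.

End Completeness.

(** * Definability with parameters *)

Section Definability.

Context {M : Type} (E : M -> M -> Prop).

(* A variable of a defining formula stands for an argument or for a parameter. *)
Definition ref (s : nat + M) (ρ : nat -> M) : M :=
  match s with inl i => ρ i | inr c => c end.

(** A property of whole assignments, so that connectives and binders need no bookkeeping of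
    arities. *)
Definition dfn (P : (nat -> M) -> Prop) : Prop :=
  exists φ v, forall ρ, sat E (fun k => ref (v k) ρ) φ <-> P ρ.

Definition dfn1 (P : M -> Prop) : Prop := dfn (fun ρ => P (ρ 0)).
Definition dfn2 (P : M -> M -> Prop) : Prop := dfn (fun ρ => P (ρ 0) (ρ 1)).

Definition tm (t : (nat -> M) -> M) : Prop := exists s, forall ρ, t ρ = ref s ρ.

Lemma tm_var i : tm (fun ρ => ρ i).
Proof. exists (inl i). reflexivity. Qed.

Lemma tm_const c : tm (fun _ => c).
Proof. exists (inr c). reflexivity. Qed.

Lemma dfn_subst P t : dfn P -> (forall k, tm (t k)) -> dfn (fun ρ => P (fun k => t k ρ)).
Proof.
  intros (φ & v & H) Ht. destruct (choice _ Ht) as [s Hs].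
  exists φ, (fun k => match v k with inl i => s i | inr c => inr c end).
  intro ρ. rewrite <- H. apply sat_ext. intro k.
  destruct (v k); cbn; auto.
Qed.

Lemma dfn_sat φ t : (forall k, tm (t k)) -> dfn (fun ρ => sat E (fun k => t k ρ) φ).
Proof.
  apply (dfn_subst (fun ρ => sat E ρ φ)). exists φ, inl. reflexivity.
Qed.

Lemma dfn1_app (P : M -> Prop) t : dfn1 P -> tm t -> dfn (fun ρ => P (t ρ)).
Proof. intros HP Ht. apply (dfn_subst _ (fun _ => t) HP). auto. Qed.

Lemma dfn2_app (P : M -> M -> Prop) t u :
  dfn2 P -> tm t -> tm u -> dfn (fun ρ => P (t ρ) (u ρ)).
Proof.
  intros HP Ht Hu. apply (dfn_subst _ (t .: fun _ => u) HP). intros [|k]; auto.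
Qed.

Lemma dfn_sat1 φ (P : M -> Prop) t :
  (forall ρ, sat E ρ φ <-> P (ρ 0)) -> tm t -> dfn (fun ρ => P (t ρ)).
Proof. intro H. apply dfn1_app. exists φ, inl. exact H. Qed.

Lemma dfn_sat2 φ (P : M -> M -> Prop) t u :
  (forall ρ, sat E ρ φ <-> P (ρ 0) (ρ 1)) -> tm t -> tm u -> dfn (fun ρ => P (t ρ) (u ρ)).
Proof. intro H. apply dfn2_app. exists φ, inl. exact H. Qed.

Lemma dfn_sat3 φ (P : M -> M -> M -> Prop) t u w :
  (forall ρ, sat E ρ φ <-> P (ρ 0) (ρ 1) (ρ 2)) -> tm t -> tm u -> tm w ->
  dfn (fun ρ => P (t ρ) (u ρ) (w ρ)).
Proof.
  intros H Ht Hu Hw.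
  apply (dfn_subst (fun ρ => P (ρ 0) (ρ 1) (ρ 2)) (t .: u .: fun _ => w)).
  - exists φ, inl. exact H.
  - intros [|[|k]]; auto.
Qed.

Lemma dfn_mem t u : tm t -> tm u -> dfn (fun ρ => E (t ρ) (u ρ)).
Proof. apply (dfn_sat2 (zfIn 0 1)). reflexivity. Qed.

Lemma dfn_eq t u : tm t -> tm u -> dfn (fun ρ => t ρ = u ρ).
Proof. apply (dfn_sat2 (zfEq 0 1)). reflexivity. Qed.

Lemma dfn_False : dfn (fun _ => False).
Proof. exists zfBot, inl. reflexivity. Qed.

(** The two formulas come with unrelated variable maps. Sending the variables of one to even indices
    and those of the other to odd indices lets a single map serve both. *)
Lemma dfn_join (op : Prop -> Prop -> Prop) (zop : zf -> zf -> zf) P Q :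
  (forall A A' B B', (A <-> A') -> (B <-> B') -> op A B <-> op A' B') ->
  (forall ρ φ ψ, sat E ρ (zop φ ψ) <-> op (sat E ρ φ) (sat E ρ ψ)) ->
  dfn P -> dfn Q -> dfn (fun ρ => op (P ρ) (Q ρ)).
Proof.
  intros Hop Hz (φ & v & HP) (ψ & w & HQ).
  exists (zop (zf_ren (fun k => 2 * k) φ) (zf_ren (fun k => 2 * k + 1) ψ)).
  exists (fun k => if Nat.even k then v (Nat.div2 k) else w (Nat.div2 k)).
  intro ρ. rewrite Hz. apply Hop.
  - rewrite <- HP. apply sat_ren. intro k.
    rewrite Nat.even_even, Nat.div2_double. reflexivity.
  - rewrite <- HQ. apply sat_ren. intro k.
    rewrite Nat.even_odd, Nat.add_1_r, Nat.div2_succ_double. reflexivity.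
Qed.

Lemma dfn_and P Q : dfn P -> dfn Q -> dfn (fun ρ => P ρ /\ Q ρ).
Proof. apply (dfn_join _ zfAnd); [tauto|reflexivity]. Qed.

Lemma dfn_or P Q : dfn P -> dfn Q -> dfn (fun ρ => P ρ \/ Q ρ).
Proof. apply (dfn_join _ zfOr); [tauto|reflexivity]. Qed.

Lemma dfn_imp P Q : dfn P -> dfn Q -> dfn (fun ρ => P ρ -> Q ρ).
Proof. apply (dfn_join (fun A B => A -> B) zfImp); [tauto|reflexivity]. Qed.

Lemma dfn_iff P Q : dfn P -> dfn Q -> dfn (fun ρ => P ρ <-> Q ρ).
Proof. apply (dfn_join _ zfIff); [tauto|reflexivity]. Qed.

Lemma dfn_not P : dfn P -> dfn (fun ρ => ~ P ρ).
Proof. intro H. apply dfn_imp; [exact H|apply dfn_False]. Qed.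

Lemma dfn_bind (P : (nat -> M) -> M -> Prop) :
  dfn (fun ρ => P (fun k => ρ (S k)) (ρ 0)) ->
  exists φ v, forall ρ x, sat E (x .: fun k => ref (v k) ρ) φ <-> P ρ x.
Proof.
  intros (φ & v & H).
  (* All variables reading argument 0 collapse to the variable being bound; the entries left at
     their old indices are never read. *)
  exists (zf_ren (fun k => match v k with inl 0 => 0 | _ => S k end) φ).
  exists (fun k => match v k with inl (S i) => inl i | s => s end).
  intros ρ x. rewrite <- (H (x .: ρ)). apply sat_ren. intro k.
  destruct (v k) as [[|i]|c] eqn:Hk; cbn; rewrite ?Hk; reflexivity.
Qed.

Lemma dfn_all P :
  dfn (fun ρ => P (fun k => ρ (S k)) (ρ 0)) -> dfn (fun ρ => forall x, P ρ x).
Proof.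
  intros (φ & v & H)%dfn_bind. exists (zfAll φ), v. intro ρ. cbn.
  split; intros Hx x; apply H, Hx.
Qed.

Lemma dfn_ex P :
  dfn (fun ρ => P (fun k => ρ (S k)) (ρ 0)) -> dfn (fun ρ => exists x, P ρ x).
Proof.
  intros (φ & v & H)%dfn_bind. exists (zfEx φ), v. intro ρ. cbn.
  split; intros [x Hx]; exists x; apply H, Hx.
Qed.

End Definability.

Ltac dfn_step :=
  cbv beta;
  first
    [ assumption
    | apply tm_var | apply tm_const
    | apply dfn_and | apply dfn_or | apply dfn_iff | apply dfn_all
    | apply dfn_imp | apply dfn_not | apply dfn_ex
    | apply dfn_eq | apply dfn_mem | apply dfn_False
    | solve [auto with dfn nocore]
    | apply dfn2_app; [assumption| |] | apply dfn1_app; [assumption|] ].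

(** * Set theory in a model of ZFC *)

Declare Scope mem_scope.
Delimit Scope mem_scope with mem.

Section Predicates.

Context {M : Type} (E : M -> M -> Prop).
Notation "x ∈ y" := (E x y) : mem_scope.
Local Open Scope mem_scope.

(* These unfold to the meaning of the macros zfSub, zfEmpty, ..., so that the
   correspondence is by conversion, except for [ord], which uses Foundation. *)
Definition sub x y := forall z, z ∈ x -> z ∈ y.
Definition empty x := forall z, ~ z ∈ x.
Definition is_succ s x := forall z, z ∈ s <-> (z ∈ x \/ z = x).
Definition is_upair s u v := forall z, z ∈ s <-> (z = u \/ z = v).
Definition is_pair p u v :=
  exists a b, is_upair a u u /\ is_upair b u v /\ is_upair p a b.
Definition app f x y := exists p, is_pair p x y /\ p ∈ f.
Definition is_fun f d :=
  (forall p, p ∈ f -> exists x y, x ∈ d /\ is_pair p x y)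
  /\ (forall x, x ∈ d -> exists y, app f x y)
  /\ (forall x y z, app f x y /\ app f x z -> y = z).
Definition tr a := forall x, x ∈ a -> sub x a.
Definition ord a := tr a /\ forall x, x ∈ a -> tr x.
Definition lim a := ord a /\ ~ empty a /\ ~ exists g, is_succ a g.
Definition is_step q w :=
  forall z, z ∈ q <-> exists x y, is_pair z x y /\ sub x w /\ sub y w.
Definition is_rec f :=
  forall b w, app f b w ->
    (empty b -> empty w)
    /\ (forall g v, is_succ b g -> app f g v -> is_step w v)
    /\ (lim b -> forall x, x ∈ w <-> exists g v, g ∈ b /\ app f g v /\ x ∈ v).
Definition level w a :=
  exists f d, is_succ d a /\ is_fun f d /\ is_rec f /\ app f a w.
Definition in_W x := exists a w, ord a /\ level w a /\ x ∈ w.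

Lemma dfn_sub t u : tm t -> tm u -> dfn E (fun ρ => sub (t ρ) (u ρ)).
Proof. apply (dfn_sat2 E (zfSub 0 1)). reflexivity. Qed.

Lemma dfn_pair t u v :
  tm t -> tm u -> tm v -> dfn E (fun ρ => is_pair (t ρ) (u ρ) (v ρ)).
Proof. apply (dfn_sat3 E (zfPair 0 1 2)). reflexivity. Qed.

Lemma dfn_app t u v :
  tm t -> tm u -> tm v -> dfn E (fun ρ => app (t ρ) (u ρ) (v ρ)).
Proof. apply (dfn_sat3 E (zfApp 0 1 2)). reflexivity. Qed.

(** Uses a formula of its own, because agreement of [ord] with [zfOrd] needs Foundation and no
    axioms are assumed yet. *)
Lemma dfn_ord t : tm t -> dfn E (fun ρ => ord (t ρ)).
Proof.
  apply (dfn_sat1 E (zfAnd (zfAll (zfImp (zfIn 0 1) (zfSub 0 1)))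
    (zfAll (zfImp (zfIn 0 1) (zfAll (zfImp (zfIn 0 1) (zfSub 0 1))))))).
  reflexivity.
Qed.

End Predicates.

Create HintDb dfn.
Hint Extern 0 (tm _) => apply tm_var : dfn.
Hint Extern 0 (tm _) => apply tm_const : dfn.
Hint Extern 1 (dfn _ (fun _ => sub _ _ _)) => apply dfn_sub : dfn.
Hint Extern 1 (dfn _ (fun _ => is_pair _ _ _ _)) => apply dfn_pair : dfn.
Hint Extern 1 (dfn _ (fun _ => app _ _ _ _)) => apply dfn_app : dfn.
Hint Extern 1 (dfn _ (fun _ => ord _ _)) => apply dfn_ord : dfn.
Ltac dfn := try unfold dfn1; try unfold dfn2; repeat dfn_step.

Section ZFModel.

Context {M : Type} (E : M -> M -> Prop).
Hypothesis ZF : forall ψ ρ, ZFC ψ -> sat E ρ ψ.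
Notation "x ∈ y" := (E x y) : mem_scope.
Local Open Scope mem_scope.

(** * Basic set constructions in the model *)

Lemma set_ext x y : (forall z, z ∈ x <-> z ∈ y) -> x = y.
(* Here and below the constant assignment is a dummy, as the axiom is closed; its satisfaction
   converts to the claim. *)
Proof. exact (ZF _ (fun _ => x) ZFC_extensionality x y). Qed.

Lemma foundation x : (exists z, z ∈ x) -> exists z, z ∈ x /\ ~ exists w, w ∈ x /\ w ∈ z.
Proof. exact (ZF _ (fun _ => x) ZFC_foundation x). Qed.

Lemma upair_ex u v : exists s, is_upair E s u v.
Proof. exact (ZF _ (fun _ => u) ZFC_pairing u v). Qed.

Lemma union_ex u : exists s, forall z, z ∈ s <-> exists y, z ∈ y /\ y ∈ u.
Proof. exact (ZF _ (fun _ => u) ZFC_union u). Qed.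

Lemma power_ex u : exists s, forall z, z ∈ s <-> sub E z u.
Proof. exact (ZF _ (fun _ => u) ZFC_power u). Qed.

Lemma choice_ex u : (forall x, x ∈ u -> exists y, y ∈ x) ->
  exists f, is_fun E f u /\ forall x, x ∈ u -> exists y, app E f x y /\ y ∈ x.
Proof. exact (ZF _ (fun _ => u) ZFC_choice u). Qed.

Lemma sep P : dfn1 E P -> forall u, exists s, forall z, z ∈ s <-> z ∈ u /\ P z.
Proof.
  intros HP u. destruct (dfn_bind E (fun _ => P) HP) as (φ & v & H).
  (* In an instance of the schema, variable 1 of the formula denotes the set being separated, so the
     parameters are moved past it. *)
  set (ψ := zf_ren (fun k => match k with 0 => 0 | S k => S (S k) end) φ).
  set (σ := fun k => ref (v k) (fun _ => u)).
  assert (Hs : sat E σ (zfc_separation ψ)).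
  { apply (sat_gen_all E (zf_bound (zfc_separation ψ))). intro ρ. apply ZF, ZFC_separation.
    apply zf_closed_gen. rewrite Nat.add_0_r. apply zf_bound_closed. }
  destruct (Hs u) as [s Hs']. exists s. intro z.
  rewrite <- (H (fun _ => u) z).
  change (sat E (z .: fun k => ref (v k) (fun _ => u)) φ) with (sat E (z .: σ) φ).
  rewrite <- (sat_ren E φ (fun k => match k with 0 => 0 | S k => S (S k) end)
    (z .: u .: σ) (z .: σ)) by (intros [|k]; reflexivity).
  fold ψ. rewrite <- (sat_ren E ψ (at1 0 2) (z .: s .: u .: σ)).
  - exact (Hs' z).
  - intros [|k]; cbn; [|rewrite Nat.add_comm]; reflexivity.
Qed.

Lemma replacement R : dfn2 E R ->
  (forall x y z, R x y /\ R x z -> y = z) ->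
  forall u, exists s, forall z, z ∈ s <-> exists w, w ∈ u /\ R w z.
Proof.
  intros (φ & v & H) HR u.
  set (ψ := zf_ren (fun k => match v k with inl 0 => 0 | inl 1 => 1 | _ => S (S k) end) φ).
  (* [R] depends on the first two arguments only; [u] is a default for all later ones. *)
  set (σ := fun k => ref (v k) (fun _ => u)).
  assert (Hψ : forall ρ, (forall k, ρ (S (S k)) = σ k) -> sat E ρ ψ <-> R (ρ 0) (ρ 1)).
  { intros ρ Hρ. rewrite <- (H (ρ 0 .: ρ 1 .: fun _ => u)).
    apply sat_ren. intro k. specialize (Hρ k). unfold σ in Hρ.
    destruct (v k) as [[|[|i]]|c]; cbn; auto. }
  assert (Hs : sat E σ (zfc_replacement ψ)).
  { apply (sat_gen_all E (zf_bound (zfc_replacement ψ))). intro ρ. apply ZF, ZFC_replacement.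
    apply zf_closed_gen. rewrite Nat.add_0_r. apply zf_bound_closed. }
  assert (Hat : forall x y d ρ, (forall k, ρ (d + k) = σ k) ->
    sat E ρ (zf_ren (at2 x y d) ψ) <-> R (ρ x) (ρ y)).
  { intros x y d ρ H1. rewrite <- (Hψ (ρ x .: ρ y .: σ)) by reflexivity.
    apply sat_ren. intros [|[|k]]; cbn; auto. rewrite Nat.add_comm; auto. }
  destruct (Hs (fun x y z => fun Hxyz => HR x y z
    (conj (proj1 (Hat 2 1 3 (z .: y .: x .: σ) (fun k => eq_refl)) (proj1 Hxyz))
      (proj1 (Hat 2 0 3 (z .: y .: x .: σ) (fun k => eq_refl)) (proj2 Hxyz)))) u) as [s Hs'].
  exists s. intro z. refine (iff_trans (Hs' z) _).
  split; intros (w & Hw & Hr); exists w; split; auto;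
    apply (Hat 0 1 4 (w .: z .: s .: u .: σ)); auto.
Qed.

Lemma sing_ex u : exists s, forall z, z ∈ s <-> z = u.
Proof.
  destruct (upair_ex u u) as [s Hs]. exists s. intro z. rewrite (Hs z). tauto.
Qed.

Lemma cup_ex x y : exists s, forall z, z ∈ s <-> z ∈ x \/ z ∈ y.
Proof.
  destruct (upair_ex x y) as [p Hp], (union_ex p) as [s Hs]. exists s. intro z.
  rewrite Hs. split.
  - intros (t & Hz & Ht). apply Hp in Ht as [-> | ->]; auto.
  - intros [H|H]; [exists x|exists y]; rewrite (Hp _); auto.
Qed.

Lemma succ_ex x : exists s, is_succ E s x.
Proof.
  destruct (sing_ex x) as [t Ht], (cup_ex x t) as [s Hs]. exists s. intro z.
  rewrite Hs, Ht. reflexivity.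
Qed.

Lemma empty_ex (x : M) : exists s, empty E s.
Proof.
  destruct (sep (fun _ => False)) with (u := x) as [s Hs]; [dfn|].
  exists s. intros z Hz. apply Hs in Hz. tauto.
Qed.

Lemma upair_fun s t u v : is_upair E s u v -> is_upair E t u v -> s = t.
Proof. intros H1 H2. apply set_ext. intro z. rewrite (H1 z), (H2 z). reflexivity. Qed.

Lemma pair_ex u v : exists p, is_pair E p u v.
Proof.
  destruct (upair_ex u u) as [a Ha], (upair_ex u v) as [b Hb], (upair_ex a b) as [p Hp].
  exists p, a, b. auto.
Qed.

Lemma pair_fun p q u v : is_pair E p u v -> is_pair E q u v -> p = q.
Proof.
  intros (a & b & Ha & Hb & Hp) (a' & b' & Ha' & Hb' & Hq).
  rewrite (upair_fun _ _ _ _ Ha' Ha), (upair_fun _ _ _ _ Hb' Hb) in Hq.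
  exact (upair_fun _ _ _ _ Hp Hq).
Qed.

Lemma upair_inj s u v u' v' : is_upair E s u v -> is_upair E s u' v' ->
  (u = u' /\ v = v') \/ (u = v' /\ v = u').
Proof. intros H1 H2. apply or_eq. intro z. rewrite <- (H1 z). apply H2. Qed.

Lemma pair_inj p u v u' v' : is_pair E p u v -> is_pair E p u' v' -> u = u' /\ v = v'.
Proof.
  intros (a & b & Ha & Hb & Hp) (a' & b' & Ha' & Hb' & Hp').
  destruct (upair_inj _ _ _ _ _ Hp Hp') as [[<- <-]|[<- <-]].
  - destruct (upair_inj _ _ _ _ _ Ha Ha'), (upair_inj _ _ _ _ _ Hb Hb');
      intuition congruence.
  - destruct (upair_inj _ _ _ _ _ Ha Hb'), (upair_inj _ _ _ _ _ Hb Ha');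
      intuition congruence.
Qed.

Lemma app_dom f d x y : is_fun E f d -> app E f x y -> x ∈ d.
Proof.
  intros [H _] (p & Hp & Hf). destruct (H p Hf) as (x' & y' & Hx & Hp').
  destruct (pair_inj _ _ _ _ _ Hp Hp') as [-> _]. exact Hx.
Qed.

Lemma succ_fun s t x : is_succ E s x -> is_succ E t x -> s = t.
Proof. intros H1 H2. apply set_ext. intro z. rewrite (H1 z), (H2 z). reflexivity. Qed.

Lemma self_in_succ s x : is_succ E s x -> x ∈ s.
Proof. intro H. apply H. auto. Qed.

Lemma no_loop2 x y : x ∈ y -> ~ y ∈ x.
Proof.
  intros Hxy Hyx. destruct (upair_ex x y) as [s Hs].
  destruct (foundation s) as (z & Hz & Hn). { exists x. apply Hs; auto. }
  apply Hn. apply Hs in Hz as [-> | ->]; [exists y|exists x]; rewrite (Hs _); auto.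
Qed.

Lemma no_loop x : ~ x ∈ x.
Proof. intro H. exact (no_loop2 x x H H). Qed.

Lemma succ_inj s x y : is_succ E s x -> is_succ E s y -> x = y.
Proof.
  intros Hx Hy. destruct (proj1 (Hx y)) as [H|]; [apply (self_in_succ s), Hy| |auto].
  destruct (proj1 (Hy x)) as [H'|]; [apply (self_in_succ s), Hx| |auto].
  destruct (no_loop2 _ _ H H').
Qed.

Lemma succ_not_empty s x : is_succ E s x -> ~ empty E s.
Proof. intros H He. exact (He x (self_in_succ _ _ H)). Qed.

(** * Ordinals *)

Lemma ord_elem a b : ord E a -> b ∈ a -> ord E b.
Proof. intros [H1 H2] Hb. split; auto. intros x Hx. apply H2, (H1 b); auto. Qed.

Lemma ord_trans a b c : ord E a -> b ∈ a -> c ∈ b -> c ∈ a.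
Proof. intros [H _] Hb Hc. exact (H b Hb c Hc). Qed.

Lemma succ_ord s a : is_succ E s a -> ord E a -> ord E s.
Proof.
  intros Hs [H1 H2]. split.
  - intros x [Hx| ->]%Hs y Hy; apply Hs; left; [exact (H1 x Hx y Hy)|exact Hy].
  - intros x [Hx| ->]%Hs; auto.
Qed.

Lemma ord_cases a : ord E a -> empty E a \/ (exists g, is_succ E a g) \/ lim E a.
Proof.
  intro H. destruct (classic (empty E a)); auto.
  destruct (classic (exists g, is_succ E a g)); auto. right; right; split; auto.
Qed.

(** Separation in the successor of [a] and Foundation give an ∈-minimal ordinal satisfying [P]. It
    is least among all ordinals because that successor is transitive. *)
Lemma ord_min P : dfn1 E P -> forall a, ord E a -> P a ->
  exists b, ord E b /\ P b /\ forall c, c ∈ b -> ~ P c.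
Proof.
  intros HP a Ha Hpa. destruct (succ_ex a) as [s Hs].
  destruct (sep P HP s) as [t Ht].
  destruct (foundation t) as (b & Hb & Hmin).
  { exists a. apply Ht. split; auto. apply (self_in_succ _ _ Hs). }
  apply Ht in Hb as [Hb Hpb]. pose proof (succ_ord _ _ Hs Ha) as Hos.
  exists b. split; [exact (ord_elem _ _ Hos Hb)|]. split; auto.
  intros c Hc Hpc. apply Hmin. exists c. rewrite Ht. split; auto.
  split; auto. exact (ord_trans _ _ _ Hos Hb Hc).
Qed.

Lemma ord_ind P : dfn1 E P ->
  (forall a, ord E a -> (forall b, b ∈ a -> P b) -> P a) -> forall a, ord E a -> P a.
Proof.
  intros HP IH a Ha. apply NNPP. intro Hn.
  destruct (ord_min (fun x => ~ P x)) with (a := a) as (b & Hb & Hpb & Hmin); auto.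
  - dfn.
  - apply Hpb, IH; auto. intros c Hc. apply NNPP. auto.
Qed.

(** Nested induction: if neither ordinal belongs to the other, the induction hypotheses show that
    they have the same elements. *)
Lemma ord_compare a b : ord E a -> ord E b -> a ∈ b \/ a = b \/ b ∈ a.
Proof.
  intros Ha. revert b.
  refine (ord_ind (fun a => forall b, ord E b -> a ∈ b \/ a = b \/ b ∈ a) _ _ a Ha);
    [dfn|].
  clear a Ha. intros a Ha IHa.
  refine (ord_ind (fun b => a ∈ b \/ a = b \/ b ∈ a) _ _); [dfn|].
  intros b Hb IHb. apply NNPP. intro Hn. apply Hn. right; left.
  apply set_ext. intro z. split; intro Hz.
  - destruct (IHa z Hz b Hb) as [|[->|H]]; auto; exfalso; [tauto|].
    apply Hn. right; right. exact (ord_trans _ _ _ Ha Hz H).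
  - destruct (IHb z Hz) as [H|[<-|]]; auto; exfalso; [|tauto].
    apply Hn. left. exact (ord_trans _ _ _ Hb Hz H).
Qed.

(** Transitivity of ∈ on [a] makes its elements transitive. Conversely, Foundation supplies
    irreflexivity and least elements, and [ord_compare] linearity. *)
Lemma sat_ord ρ a : sat E ρ (zfOrd a) <-> ord E (ρ a).
Proof.
  split.
  - intros (H1 & _ & H3 & _). split; [exact H1|].
    intros x Hx y Hy z Hz. pose proof (H1 x Hx y Hy) as Hya.
    exact (H3 z y x (conj (H1 y Hya z Hz) (conj Hya Hx)) Hz Hy).
  - intros Ha. split; [exact (proj1 Ha)|]. split; [|split; [|split]].
    + intros x Hx. exact (no_loop x).
    + intros x y z (_ & _ & Hz) Hxy Hyz. exact (proj2 Ha z Hz y Hyz x Hxy).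
    + intros x y (Hx & Hy). apply ord_compare; eapply ord_elem; eauto.
    + intros s [Hs Hne]. cbn in Hs, Hne |- *.
      destruct (foundation s) as (m & Hm & Hmin).
      { apply NNPP. intro Hn. apply Hne. intros z Hz. apply Hn. eauto. }
      exists m. split; auto. intros y Hy.
      destruct (ord_compare m y) as [|[|]]; auto; try (eapply ord_elem; eauto; fail).
      exfalso. eauto.
Qed.

Lemma sat_lim ρ a : sat E ρ (zfLim a) <-> lim E (ρ a).
Proof.
  change (sat E ρ (zfLim a)) with (sat E ρ (zfOrd a) /\ ~ empty E (ρ a) /\
    ~ exists g, is_succ E (ρ a) g).
  rewrite sat_ord. reflexivity.
Qed.

Lemma sat_rec ρ f : sat E ρ (wIsRec f) <-> is_rec E (ρ f).
Proof.
  split; intros H b w Hw; destruct (H b w Hw) as (H1 & H2 & H3);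
    (split; [exact H1|split; [exact H2|]]); intro Hl;
    refine (H3 _); apply (sat_lim (w .: b .: ρ) 1), Hl.
Qed.

Lemma sat_level ρ w a : sat E ρ (wIsLevel w a) <-> level E (ρ w) (ρ a).
Proof.
  split; intros (f & d & H1 & H2 & H3 & H4); exists f, d;
    (split; [exact H1|split; [exact H2|split; [|exact H4]]]);
    apply (sat_rec (d .: f .: ρ) 1), H3.
Qed.

Lemma sat_in_W ρ x : sat E ρ (inW x) <-> in_W E (ρ x).
Proof.
  split; intros (a & w & H1 & H2 & H3); exists a, w.
  - split; [exact (proj1 (sat_ord (w .: a .: ρ) 1) H1)|].
    split; [exact (proj1 (sat_level (w .: a .: ρ) 0 1) H2)|exact H3].
  - split; [exact (proj2 (sat_ord (w .: a .: ρ) 1) H1)|].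
    split; [exact (proj2 (sat_level (w .: a .: ρ) 0 1) H2)|exact H3].
Qed.

Lemma dfn_level t u : tm t -> tm u -> dfn E (fun ρ => level E (t ρ) (u ρ)).
Proof. apply (dfn_sat2 E (wIsLevel 0 1)). intro. apply sat_level. Qed.

Lemma dfn_in_W t : tm t -> dfn E (fun ρ => in_W E (t ρ)).
Proof. apply (dfn_sat1 E (inW 0)). intro. apply sat_in_W. Qed.

Hint Extern 1 (dfn _ (fun _ => level _ _ _)) => apply dfn_level : dfn.
Hint Extern 1 (dfn _ (fun _ => in_W _ _)) => apply dfn_in_W : dfn.

(** * The cumulative hierarchy *)

(** The domains may differ, so agreement is claimed only at common arguments; both domains are
    transitive, hence the recursion never leaves them. *)
Lemma rec_agree f d g e : ord E d -> ord E e ->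
  is_fun E f d -> is_fun E g e -> is_rec E f -> is_rec E g ->
  forall b v w, app E f b v -> app E g b w -> v = w.
Proof.
  intros Hd He Hf Hg Rf Rg b v w Hv Hw.
  assert (Hb : ord E b) by exact (ord_elem _ _ Hd (app_dom _ _ _ _ Hf Hv)).
  revert v w Hv Hw.
  refine (ord_ind (fun b => forall v w, app E f b v -> app E g b w -> v = w) _ _ b Hb);
    [dfn|].
  clear b Hb. intros b Hb IH v w Hv Hw.
  pose proof (app_dom _ _ _ _ Hf Hv) as Hbd. pose proof (app_dom _ _ _ _ Hg Hw) as Hbe.
  destruct (Rf b v Hv) as (F1 & F2 & F3), (Rg b w Hw) as (G1 & G2 & G3).
  apply set_ext. intro z. destruct (ord_cases b Hb) as [H|[[c Hc]|H]].
  - pose proof (F1 H z). pose proof (G1 H z). tauto.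
  - pose proof (self_in_succ _ _ Hc) as Hcb.
    destruct (proj1 (proj2 Hf) c (ord_trans _ _ _ Hd Hbd Hcb)) as [v' Hv'].
    destruct (proj1 (proj2 Hg) c (ord_trans _ _ _ He Hbe Hcb)) as [w' Hw'].
    rewrite <- (IH c Hcb _ _ Hv' Hw') in Hw'.
    rewrite (F2 _ _ Hc Hv' z), (G2 _ _ Hc Hw' z). reflexivity.
  - rewrite (F3 H z), (G3 H z). split; intros (c & v' & Hcb & Hv' & Hz); exists c.
    + destruct (proj1 (proj2 Hg) c (ord_trans _ _ _ He Hbe Hcb)) as [w' Hw'].
      exists w'. rewrite <- (IH c Hcb _ _ Hv' Hw'). rewrite <- (IH c Hcb _ _ Hv' Hw') in Hw'. auto.
    + destruct (proj1 (proj2 Hf) c (ord_trans _ _ _ Hd Hbd Hcb)) as [w' Hw'].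
      exists w'. rewrite (IH c Hcb _ _ Hw' Hv'). rewrite (IH c Hcb _ _ Hw' Hv') in Hw'. auto.
Qed.

Lemma level_agree f d a v w : ord E d -> is_fun E f d -> is_rec E f -> ord E a ->
  app E f a v -> level E w a -> v = w.
Proof.
  intros Hd Hf Rf Ha Hv (g & e & He & Hg & Rg & Hw).
  exact (rec_agree f d g e Hd (succ_ord _ _ He Ha) Hf Hg Rf Rg a v w Hv Hw).
Qed.

Lemma level_fun a v w : ord E a -> level E v a -> level E w a -> v = w.
Proof.
  intros Ha (g & e & He & Hg & Rg & Hw).
  exact (level_agree g e a v w (succ_ord _ _ He Ha) Hg Rg Ha Hw).
Qed.

Lemma level_zero a w : empty E a -> level E w a -> empty E w.
Proof. intros Ha (g & e & He & Hg & Rg & Hw). exact (proj1 (Rg _ _ Hw) Ha). Qed.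

Lemma level_succ a b v w : ord E b -> is_succ E a b -> level E v b -> level E w a -> is_step E w v.
Proof.
  intros Hb Ha Hv (g & e & He & Hg & Rg & Hw).
  pose proof (succ_ord _ _ He (succ_ord _ _ Ha Hb)) as Hoe.
  destruct (proj1 (proj2 Hg) b) as [v' Hv'].
  { apply He. left. exact (self_in_succ _ _ Ha). }
  rewrite <- (level_agree g e b v' v Hoe Hg Rg Hb Hv' Hv).
  exact (proj1 (proj2 (Rg _ _ Hw)) b v' Ha Hv').
Qed.

(** Existence of the earlier levels is assumed because the lemma is used inside the induction that
    establishes it. *)
Lemma level_lim_of a w : lim E a -> (forall b, b ∈ a -> exists v, level E v b) ->
  level E w a -> forall x, x ∈ w <-> exists b v, b ∈ a /\ level E v b /\ x ∈ v.
Proof.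
  intros Ha Hex (g & e & He & Hg & Rg & Hw) x.
  pose proof (succ_ord _ _ He (proj1 Ha)) as Hoe.
  assert (H : forall b v w, b ∈ a -> app E g b v -> level E w b -> v = w).
  { intros b v w' Hb. apply (level_agree g e); auto. exact (ord_elem _ _ (proj1 Ha) Hb). }
  rewrite (proj2 (proj2 (Rg _ _ Hw)) Ha x).
  split; intros (b & v & Hb & Hv & Hx); exists b.
  - destruct (Hex b Hb) as [v' Hv']. exists v'. rewrite (H b v v') in Hx; auto.
  - destruct (proj1 (proj2 Hg) b) as [v' Hv']. { apply He; auto. }
    exists v'. rewrite <- (H b v' v) in Hx; auto.
Qed.

Lemma step_ex v : exists w, is_step E w v.
Proof.
  (* A Kuratowski pair of subsets of [v] belongs to the third iterated power set of [v]. *)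
  destruct (power_ex v) as [p Hp], (power_ex p) as [pp Hpp], (power_ex pp) as [q Hq].
  destruct (sep (fun z => exists x y, is_pair E z x y /\ sub E x v /\ sub E y v))
    with (u := q) as [w Hw]; [dfn|].
  exists w. intro z. rewrite Hw. split; [tauto|]. intro H. split; [|exact H].
  destruct H as (x & y & (a & b & Ha & Hb & Hz) & Hx & Hy).
  apply Hq. intros c Hc. apply Hpp. intros e He. apply Hp.
  apply Hz in Hc as [-> | ->]; [apply Ha in He|apply Hb in He]; destruct He as [-> | ->]; auto.
Qed.

Lemma level_ex a : ord E a -> exists w, level E w a.
Proof.
  apply (ord_ind (fun a => exists w, level E w a)); [dfn|].
  clear a. intros a Ha IH.
  assert (Hoe : forall b, b ∈ a -> ord E b) by (intros b; apply (ord_elem a b Ha)).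
  (* The value at [a] is found first, in terms of the relation [level] below [a]; a recursion
     function is built around it afterwards. *)
  assert (Hw : exists w, (empty E a -> empty E w) /\
    (forall g v, is_succ E a g -> level E v g -> is_step E w v) /\
    (lim E a -> forall x, x ∈ w <-> exists g v, g ∈ a /\ level E v g /\ x ∈ v)).
  { destruct (ord_cases a Ha) as [H|[[g Hg]|H]].
    - exists a. split; [auto|]. split.
      + intros g v Hg. destruct (succ_not_empty _ _ Hg H).
      + intros (_ & Hl & _). tauto.
    - destruct (IH g (self_in_succ _ _ Hg)) as [v Hv], (step_ex v) as [w Hw].
      exists w. split; [|split].
      + intro H. destruct (succ_not_empty _ _ Hg H).
      + intros g' v' Hg' Hv'. rewrite <- (succ_inj _ _ _ Hg Hg') in Hv'.
        rewrite (level_fun g v' v); auto. apply Hoe, (self_in_succ _ _ Hg).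
      + intros (_ & _ & Hl). destruct Hl; eauto.
    - destruct (replacement (fun g v => g ∈ a /\ level E v g)) with (u := a) as [t Ht].
      { dfn. }
      { intros x y z [[Hx Hy] [_ Hz]]. exact (level_fun x y z (Hoe x Hx) Hy Hz). }
      destruct (union_ex t) as [w Hw]. exists w. split; [|split].
      + intro He. destruct H as (_ & Hl & _). tauto.
      + intros g v Hg. destruct H as (_ & _ & Hl). destruct Hl; eauto.
      + intros _ x. rewrite Hw. split.
        * intros (v & Hx & Hv). apply Ht in Hv as (g & _ & Hg & Hv). eauto.
        * intros (g & v & Hg & Hv & Hx). exists v. rewrite Ht. eauto. }
  destruct Hw as [w (W1 & W2 & W3)], (succ_ex a) as [d Hd].
  (* The graph of b ↦ W_b below [a], with the pair of [a] and [w] on top. Levels are unique, so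
     Replacement applies. *)
  destruct (replacement (fun b p => exists v, is_pair E p b v /\
    ((b ∈ a /\ level E v b) \/ (b = a /\ v = w)))) with (u := d) as [f Hf].
  { dfn. }
  { intros b p q [(v & Hp & Hv) (v' & Hq & Hv')]. replace v' with v in Hq.
    - exact (pair_fun _ _ _ _ Hp Hq).
    - destruct Hv as [[Hb Hv]|[-> ->]], Hv' as [[Hb' Hv']|[Hb' ->]]; auto.
      + exact (level_fun b v v' (Hoe b Hb) Hv Hv').
      + subst b. destruct (no_loop _ Hb).
      + destruct (no_loop _ Hb'). }
  assert (Happ : forall b v, app E f b v <-> (b ∈ a /\ level E v b) \/ (b = a /\ v = w)).
  { intros b v. split.
    - intros (p & Hp & Hpf). apply Hf in Hpf as (b' & Hb' & v' & Hp' & Hv).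
      destruct (pair_inj _ _ _ _ _ Hp Hp') as [-> ->]. exact Hv.
    - intro Hv. destruct (pair_ex b v) as [p Hp]. exists p. split; [exact Hp|].
      apply Hf. exists b. split; [|exists v; auto]. apply Hd. tauto. }
  assert (Hlow : forall b v, b ∈ a -> app E f b v <-> level E v b).
  { intros b v Hb. rewrite Happ. split; [|tauto].
    intros [[_ H]|[-> _]]; [exact H|]. destruct (no_loop _ Hb). }
  exists w, f, d. split; [exact Hd|]. split; [|split; [|apply Happ; auto]].
  - split; [|split].
    + intros p Hp. apply Hf in Hp as (b & Hb & v & Hp & _). eauto.
    + intros b [Hb| ->]%Hd.
      * destruct (IH b Hb) as [v Hv]. exists v. apply Happ; auto.
      * exists w. apply Happ; auto.
    + intros b v v' [Hv Hv']. apply Happ in Hv, Hv'.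
      destruct Hv as [[Hb Hv]|[-> ->]], Hv' as [[Hb' Hv']|[Hb' ->]]; auto.
      * exact (level_fun b v v' (Hoe b Hb) Hv Hv').
      * subst b. destruct (no_loop _ Hb).
      * destruct (no_loop _ Hb').
  - intros b u Hu. apply Happ in Hu as [[Hb Hu]|[-> ->]].
    + assert (Hcb : forall c, c ∈ b -> c ∈ a) by (intro c; apply (ord_trans a b c Ha Hb)).
      split; [|split].
      * intro He. exact (level_zero _ _ He Hu).
      * intros g v Hg Hv. pose proof (Hcb _ (self_in_succ _ _ Hg)) as Hga.
        apply Hlow in Hv; auto. exact (level_succ _ _ _ _ (Hoe g Hga) Hg Hv Hu).
      * intros Hl x. rewrite (level_lim_of b u Hl (fun c Hc => IH c (Hcb c Hc)) Hu x).
        split; intros (g & v & Hg & Hv & Hx); exists g, v;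
          (split; [exact Hg|split; [apply Hlow|exact Hx]]); auto.
    + split; [exact W1|]. split.
      * intros g v Hg Hv. apply (W2 g v Hg). apply Hlow; auto. exact (self_in_succ _ _ Hg).
      * intros Hl x. rewrite (W3 Hl x).
        split; intros (g & v & Hg & Hv & Hx); exists g, v;
          (split; [exact Hg|split; [apply Hlow|exact Hx]]); auto.
Qed.

Lemma level_lim a w : lim E a -> level E w a ->
  forall x, x ∈ w <-> exists b v, b ∈ a /\ level E v b /\ x ∈ v.
Proof.
  intro Ha. apply level_lim_of; auto. intros b Hb.
  exact (level_ex b (ord_elem _ _ (proj1 Ha) Hb)).
Qed.

(** Components live at a strictly earlier level. This drop in rank drives both monotonicity of the
    hierarchy and induction on W. *)
Lemma level_elem a w x : ord E a -> level E w a -> x ∈ w ->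
  exists p q b v, is_pair E x p q /\ b ∈ a /\ level E v b /\ sub E p v /\ sub E q v.
Proof.
  intro Ha. revert w x.
  refine (ord_ind (fun a => forall w x, level E w a -> x ∈ w ->
    exists p q b v, is_pair E x p q /\ b ∈ a /\ level E v b /\ sub E p v /\ sub E q v)
    _ _ a Ha); [dfn|].
  clear a Ha. intros a Ha IH w x Hw Hx.
  destruct (ord_cases a Ha) as [H|[[g Hg]|H]].
  - destruct (level_zero _ _ H Hw _ Hx).
  - pose proof (self_in_succ _ _ Hg) as Hga. pose proof (ord_elem _ _ Ha Hga) as Hog.
    destruct (level_ex g Hog) as [v Hv].
    apply (level_succ _ _ _ _ Hog Hg Hv Hw) in Hx as (p & q & Hx & Hp & Hq).
    exists p, q, g, v. auto.
  - apply (level_lim _ _ H Hw) in Hx as (b & v & Hb & Hv & Hx).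
    destruct (IH b Hb v x Hv Hx) as (p & q & c & u & H1 & Hc & H2).
    exists p, q, c, u. split; [exact H1|]. split; [|exact H2]. exact (ord_trans _ _ _ Ha Hb Hc).
Qed.

Lemma level_mono a b v w : ord E a -> b ∈ a -> level E v b -> level E w a -> sub E v w.
Proof.
  intro Ha. revert b v w.
  refine (ord_ind (fun a => forall b v w, b ∈ a -> level E v b -> level E w a -> sub E v w)
    _ _ a Ha); [dfn|].
  clear a Ha. intros a Ha IH b v w Hb Hv Hw.
  destruct (ord_cases a Ha) as [H|[[g Hg]|H]].
  - destruct (H _ Hb).
  - pose proof (self_in_succ _ _ Hg) as Hga. pose proof (ord_elem _ _ Ha Hga) as Hog.
    destruct (level_ex g Hog) as [u Hu].
    (* Components of an element of W_g lie in an earlier level, hence in W_g by induction, so the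
       element reappears in the next level. *)
    assert (Huw : sub E u w).
    { intros x Hx. destruct (level_elem g u x Hog Hu Hx) as (p & q & c & t & Hp & Hc & Ht & H1 & H2).
      apply (level_succ _ _ _ _ Hog Hg Hu Hw). exists p, q. split; [exact Hp|].
      pose proof (IH g Hga c t u Hc Ht Hu) as Htu. split; intros y Hy; apply Htu; auto. }
    apply Hg in Hb as [Hb| ->].
    + intros x Hx. apply Huw. exact (IH g Hga b v u Hb Hv Hu x Hx).
    + rewrite (level_fun g v u Hog Hv Hu). exact Huw.
  - intros x Hx. apply (level_lim _ _ H Hw). eauto.
Qed.

(* By Replacement, the least ranks of the elements of s form a set. *)
Lemma level_bound s : (forall x, x ∈ s -> in_W E x) ->
  exists a w, ord E a /\ level E w a /\ sub E s w.
Proof.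
  intro Hs.
  set (rk := fun x a => ord E a /\ (exists w, level E w a /\ x ∈ w) /\
    forall b, b ∈ a -> ~ exists w, level E w b /\ x ∈ w).
  destruct (replacement rk) with (u := s) as [t Ht].
  { unfold rk. dfn. }
  { intros x a b [(Ha & Hxa & Hma) (Hb & Hxb & Hmb)].
    destruct (ord_compare a b Ha Hb) as [H|[H|H]]; auto; exfalso;
      [exact (Hmb _ H Hxa)|exact (Hma _ H Hxb)]. }
  assert (Hot : forall b, b ∈ t -> ord E b).
  { intros b Hb. apply Ht in Hb as (x & _ & Hb & _). exact Hb. }
  (* [m] is the supremum of the ranks: a rank above [m] would give [m ∈ m]. *)
  destruct (union_ex t) as [m Hm].
  assert (Hom : ord E m).
  { split.
    - intros x (b & Hx & Hb)%Hm y Hy. apply Hm. exists b. split; auto.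
      exact (ord_trans _ _ _ (Hot b Hb) Hx Hy).
    - intros x (b & Hx & Hb)%Hm. exact (proj2 (Hot b Hb) x Hx). }
  destruct (level_ex m Hom) as [w Hw]. exists m, w. split; [auto|]. split; [auto|].
  intros x Hx. destruct (Hs x Hx) as (a & v & Ha & Hv & Hxv).
  destruct (ord_min (fun a => exists w, level E w a /\ x ∈ w)) with (a := a)
    as (b & Hb & (u & Hu & Hxu) & Hmin); [dfn|auto|eauto|].
  assert (Hbt : b ∈ t). { apply Ht. exists x. split; auto. split; eauto. }
  destruct (ord_compare b m Hb Hom) as [H|[->|H]].
  - exact (level_mono m b u w Hom H Hu Hw x Hxu).
  - rewrite (level_fun m w u); auto.
  - destruct (no_loop m). apply Hm. eauto.
Qed.

(** From right to left, all elements of [p] and [q] fit into one level by [level_bound], and [x]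
    appears in the next one. *)
Lemma in_W_iff x : in_W E x <-> exists p q, is_pair E x p q /\
  (forall y, y ∈ p -> in_W E y) /\ (forall y, y ∈ q -> in_W E y).
Proof.
  split.
  - intros (a & w & Ha & Hw & Hx).
    destruct (level_elem a w x Ha Hw Hx) as (p & q & b & v & Hp & Hb & Hv & H1 & H2).
    pose proof (ord_elem _ _ Ha Hb).
    exists p, q. split; [exact Hp|]. split; intros y Hy; exists b, v; auto.
  - intros (p & q & Hx & Hp & Hq). destruct (cup_ex p q) as [s Hs].
    destruct (level_bound s) as (a & v & Ha & Hv & Hsv).
    { intros y [Hy|Hy]%Hs; auto. }
    destruct (succ_ex a) as [b Hb]. pose proof (succ_ord _ _ Hb Ha) as Hob.
    destruct (level_ex b Hob) as [w Hw]. exists b, w. split; [auto|]. split; [auto|].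
    apply (level_succ _ _ _ _ Ha Hb Hv Hw). exists p, q. split; [exact Hx|].
    split; intros y Hy; apply Hsv, Hs; auto.
Qed.

Lemma in_W_ind P : dfn1 E P ->
  (forall x p q, in_W E x -> is_pair E x p q ->
    (forall y, y ∈ p -> P y) -> (forall y, y ∈ q -> P y) -> P x) ->
  forall x, in_W E x -> P x.
Proof.
  intros HP IH x (a & w & Ha & Hw & Hx). revert w x Hw Hx.
  refine (ord_ind (fun a => forall w x, level E w a -> x ∈ w -> P x) _ _ a Ha); [dfn|].
  clear a Ha. intros a Ha IHa w x Hw Hx.
  destruct (level_elem a w x Ha Hw Hx) as (p & q & b & v & Hp & Hb & Hv & H1 & H2).
  apply (IH x p q); eauto. exists a, w. auto.
Qed.

(** * A limit ordinal and its level *)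

Lemma lim_ex (x : M) : exists a, lim E a.
Proof.
  destruct (ZF _ (fun _ => x) ZFC_infinity) as [i [(e & He & Hei) Hi]].
  change (empty E e) in He. change (e ∈ i) in Hei.
  assert (Hsi : forall x s, x ∈ i -> is_succ E s x -> s ∈ i).
  { intros y s Hy Hs. destruct (Hi y Hy) as (s' & Hs' & Hsi).
    rewrite (succ_fun s s' y Hs Hs'). exact Hsi. }
  destruct (sep (ord E)) with (u := i) as [t Ht]; [dfn|].
  (* The ordinals of an inductive set need not form a transitive set, so their union is taken.
     Closure of [t] under successor puts [t] inside [m] and leaves [m] without a largest element. *)
  destruct (union_ex t) as [m Hm].
  assert (Hup : forall b s, b ∈ t -> is_succ E s b -> s ∈ t).
  { intros b s Hb Hs. apply Ht in Hb as [Hb Hob]. apply Ht. split; eauto.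
    exact (succ_ord _ _ Hs Hob). }
  assert (Htm : forall b, b ∈ t -> b ∈ m).
  { intros b Hb. destruct (succ_ex b) as [s Hs]. apply Hm. exists s.
    split; [exact (self_in_succ _ _ Hs)|eauto]. }
  exists m. split; [split|split].
  - intros y (b & Hy & Hb)%Hm z Hz. apply Hm. exists b. split; auto.
    apply Ht in Hb as [_ Hb]. exact (ord_trans _ _ _ Hb Hy Hz).
  - intros y (b & Hy & Hb)%Hm. apply Ht in Hb as [_ Hb]. exact (proj2 Hb y Hy).
  - intro Hn. apply (Hn e), Htm, Ht. split; auto.
    split; intros y Hy; destruct (He y Hy).
  - intros [g Hg]. pose proof (self_in_succ _ _ Hg) as Hgm.
    apply Hm in Hgm as (b & Hgb & Hb). pose proof (Htm b Hb) as Hbm.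
    apply Hg in Hbm as [Hbg| ->]; [exact (no_loop2 _ _ Hbg Hgb)|exact (no_loop _ Hgb)].
Qed.

Lemma lim_succ a b s : lim E a -> b ∈ a -> is_succ E s b -> s ∈ a.
Proof.
  intros (Ha & _ & Hl) Hb Hs. pose proof (ord_elem _ _ Ha Hb) as Hob.
  destruct (ord_compare s a (succ_ord _ _ Hs Hob) Ha) as [H|[->|H]]; auto.
  - destruct Hl; eauto.
  - apply Hs in H as [H| ->]; [destruct (no_loop2 _ _ Hb H)|destruct (no_loop _ Hb)].
Qed.

(** The set is W_λ for a limit λ. Inclusions are enough for [p'] and [q'], since the level after W_b
    contains all pairs of subsets of W_b. *)
Lemma inductive_ex (x0 : M) : exists s, (forall x, x ∈ s -> in_W E x) /\
  (forall e p, empty E p -> is_pair E e p p -> e ∈ s) /\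
  (forall x y p q p' q', x ∈ s -> is_pair E x p q -> is_pair E y p' q' ->
    (forall z, z ∈ p' -> z ∈ p \/ z = x) -> (forall z, z ∈ q' -> z ∈ q \/ z = x) -> y ∈ s).
Proof.
  destruct (lim_ex x0) as [a Ha]. pose proof (proj1 Ha) as Hoa.
  destruct (level_ex a Hoa) as [s Hs].
  assert (Hnext : forall b v p q y, b ∈ a -> level E v b -> is_pair E y p q ->
    sub E p v -> sub E q v -> y ∈ s).
  { intros b v p q y Hb Hv Hy Hp Hq. destruct (succ_ex b) as [c Hc].
    pose proof (lim_succ _ _ _ Ha Hb Hc) as Hca. pose proof (ord_elem _ _ Hoa Hca) as Hoc.
    destruct (level_ex c Hoc) as [w Hw]. apply (level_lim a s Ha Hs). exists c, w.
    split; [auto|]. split; [auto|].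
    apply (level_succ _ _ _ _ (ord_elem _ _ Hoa Hb) Hc Hv Hw). exists p, q. auto. }
  exists s. split; [|split].
  - intros x Hx. exists a, s. auto.
  - intros e p Hp He. destruct Ha as (_ & Hne & _).
    apply not_all_ex_not in Hne as [b Hb]. apply NNPP in Hb.
    destruct (level_ex b (ord_elem _ _ Hoa Hb)) as [v Hv].
    apply (Hnext b v p p e); auto; intros z Hz; destruct (Hp z Hz).
  - intros x y p q p' q' Hx Hxp Hy Hp' Hq'.
    apply (level_lim a s Ha Hs) in Hx as (b & v & Hb & Hv & Hx).
    pose proof (ord_elem _ _ Hoa Hb) as Hob.
    destruct (level_elem b v x Hob Hv Hx) as (p1 & q1 & c & u & Hx' & Hc & Hu & H1 & H2).
    destruct (pair_inj _ _ _ _ _ Hxp Hx') as [<- <-].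
    pose proof (level_mono b c u v Hob Hc Hu Hv) as Huv.
    apply (Hnext b v p' q' y); auto.
    + intros z Hz. apply Hp' in Hz as [Hz| ->]; auto.
    + intros z Hz. apply Hq' in Hz as [Hz| ->]; auto.
Qed.

End ZFModel.

(** * The T/F-model on W *)

Section TFModel.

Context {M : Type} (E : M -> M -> Prop).
Hypothesis ZF : forall ψ ρ, ZFC ψ -> sat E ρ ψ.
Notation "x ∈ y" := (E x y) : mem_scope.
Local Open Scope mem_scope.

Definition W : Type := {x : M | in_W E x}.
Definition val (x : W) : M := proj1_sig x.

Definition inT (y x : W) : Prop := exists a b, is_pair E (val x) a b /\ val y ∈ a.
Definition inF (y x : W) : Prop := exists a b, is_pair E (val x) a b /\ ~ val y ∈ b.
Definition eqF (x y : W) : Prop := exists a b c d,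
  is_pair E (val x) a b /\ is_pair E (val y) c d /\
  ((exists z, z ∈ a /\ ~ z ∈ d) \/ (exists z, z ∈ c /\ ~ z ∈ b)).

(** The set may have members outside W; only its trace on W counts, and [small_W] trims it. *)
Definition small (P : W -> Prop) : Prop := exists a, forall d, val d ∈ a <-> P d.

(** [Q] is constrained only at assignments with values in W, hence the relativizations to [in_W] in
    what follows. *)
Definition defin (P : (nat -> W) -> Prop) : Prop :=
  exists Q, dfn E Q /\ forall ρ, Q (fun k => val (ρ k)) <-> P ρ.
Definition dtm (t : (nat -> W) -> W) : Prop :=
  exists s, tm s /\ forall ρ, val (t ρ) = s (fun k => val (ρ k)).

Lemma val_inj x y : val x = val y -> x = y.
Proof. destruct x, y. apply subset_eq_compat. Qed.

Lemma dtm_var i : dtm (fun ρ => ρ i).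
Proof. exists (fun ρ => ρ i). split; [apply tm_var|reflexivity]. Qed.

Lemma dtm_const c : dtm (fun _ => c).
Proof. exists (fun _ => val c). split; [apply tm_const|reflexivity]. Qed.

Lemma defin_subst P t :
  defin P -> (forall k, dtm (t k)) -> defin (fun ρ => P (fun k => t k ρ)).
Proof.
  intros (Q & HQ & H) Ht. destruct (choice _ Ht) as [s Hs].
  exists (fun ρ => Q (fun k => s k ρ)). split.
  - apply dfn_subst; auto. apply Hs.
  - intro ρ. rewrite <- H. replace (fun k => val (t k ρ))
      with (fun k => s k (fun k => val (ρ k))); [reflexivity|].
    extensionality k. symmetry. apply Hs.
Qed.

Lemma defin_app1 (P : W -> Prop) t :
  defin (fun ρ => P (ρ 0)) -> dtm t -> defin (fun ρ => P (t ρ)).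
Proof. intros HP Ht. apply (defin_subst _ (fun _ => t) HP). auto. Qed.

Lemma defin_app2 (P : W -> W -> Prop) t u :
  defin (fun ρ => P (ρ 0) (ρ 1)) -> dtm t -> dtm u -> defin (fun ρ => P (t ρ) (u ρ)).
Proof.
  intros HP Ht Hu. apply (defin_subst _ (t .: fun _ => u) HP). intros [|k]; auto.
Qed.

Lemma defin_eq t u : dtm t -> dtm u -> defin (fun ρ => t ρ = u ρ).
Proof.
  apply (defin_app2 (fun x y => x = y)). exists (fun ρ => ρ 0 = ρ 1). split; [dfn|].
  intro ρ. split; [apply val_inj|congruence].
Qed.

Lemma defin_inT t u : dtm t -> dtm u -> defin (fun ρ => inT (t ρ) (u ρ)).
Proof.
  apply (defin_app2 inT). exists (fun ρ => exists a b, is_pair E (ρ 1) a b /\ ρ 0 ∈ a).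
  split; [dfn|reflexivity].
Qed.

Lemma defin_inF t u : dtm t -> dtm u -> defin (fun ρ => inF (t ρ) (u ρ)).
Proof.
  apply (defin_app2 inF). exists (fun ρ => exists a b, is_pair E (ρ 1) a b /\ ~ ρ 0 ∈ b).
  split; [dfn|reflexivity].
Qed.

Lemma defin_False : defin (fun _ => False).
Proof. exists (fun _ => False). split; [dfn|reflexivity]. Qed.

Lemma defin_True : defin (fun _ => True).
Proof. exists (fun _ => False -> False). split; [dfn|tauto]. Qed.

Lemma defin_join (op : Prop -> Prop -> Prop) P Q :
  (forall A A' B B', (A <-> A') -> (B <-> B') -> op A B <-> op A' B') ->
  (forall P Q, dfn E P -> dfn E Q -> dfn E (fun ρ => op (P ρ) (Q ρ))) ->
  defin P -> defin Q -> defin (fun ρ => op (P ρ) (Q ρ)).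
Proof.
  intros Hop Hd (P' & HP' & HP) (Q' & HQ' & HQ).
  exists (fun ρ => op (P' ρ) (Q' ρ)). auto.
Qed.

Lemma defin_and P Q : defin P -> defin Q -> defin (fun ρ => P ρ /\ Q ρ).
Proof. apply defin_join; [tauto|apply dfn_and]. Qed.

Lemma defin_or P Q : defin P -> defin Q -> defin (fun ρ => P ρ \/ Q ρ).
Proof. apply defin_join; [tauto|apply dfn_or]. Qed.

Lemma defin_imp P Q : defin P -> defin Q -> defin (fun ρ => P ρ -> Q ρ).
Proof. apply (defin_join (fun A B => A -> B)); [tauto|apply dfn_imp]. Qed.

Lemma defin_iff P Q : defin P -> defin Q -> defin (fun ρ => P ρ <-> Q ρ).
Proof. apply defin_join; [tauto|apply dfn_iff]. Qed.

Lemma defin_not P : defin P -> defin (fun ρ => ~ P ρ).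
Proof. intro H. apply defin_imp; [exact H|apply defin_False]. Qed.

Lemma scons_val (x : W) ρ : (val x .: fun k => val (ρ k)) = fun k => val ((x .: ρ) k).
Proof. extensionality k. destruct k; reflexivity. Qed.

Lemma scons_eta {A} (ρ : nat -> A) : (ρ 0 .: fun k => ρ (S k)) = ρ.
Proof. extensionality k. destruct k; reflexivity. Qed.

Lemma defin_bind (P : (nat -> W) -> W -> Prop) :
  defin (fun ρ => P (fun k => ρ (S k)) (ρ 0)) ->
  exists Q : (nat -> M) -> M -> Prop, dfn E (fun ρ => Q (fun k => ρ (S k)) (ρ 0)) /\
    forall ρ x, Q (fun k => val (ρ k)) (val x) <-> P ρ x.
Proof.
  intros (Q & HQ & H). exists (fun ρ x => Q (x .: ρ)). split.
  - replace (fun ρ => Q (ρ 0 .: fun k => ρ (S k))) with Q; [exact HQ|].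
    extensionality ρ. rewrite scons_eta. reflexivity.
  - intros ρ x. rewrite scons_val, H. reflexivity.
Qed.

Lemma defin_all P :
  defin (fun ρ => P (fun k => ρ (S k)) (ρ 0)) -> defin (fun ρ => forall x, P ρ x).
Proof.
  intros (Q & HQ & H)%defin_bind. exists (fun ρ => forall x, in_W E x -> Q ρ x). split.
  - apply dfn_all. apply dfn_imp; [apply (dfn_in_W E ZF), tm_var|exact HQ].
  - intro ρ. split.
    + intros HP x. apply H, HP. exact (proj2_sig x).
    + intros HP x Hx. apply (H ρ (exist _ x Hx)), HP.
Qed.

Lemma defin_ex P :
  defin (fun ρ => P (fun k => ρ (S k)) (ρ 0)) -> defin (fun ρ => exists x, P ρ x).
Proof.
  intros (Q & HQ & H)%defin_bind. exists (fun ρ => exists x, in_W E x /\ Q ρ x). split.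
  - apply dfn_ex. apply dfn_and; [apply (dfn_in_W E ZF), tm_var|exact HQ].
  - intro ρ. split.
    + intros (x & Hx & HP). exists (exist _ x Hx). apply (H ρ (exist _ x Hx)), HP.
    + intros [x HP]. exists (val x). split; [exact (proj2_sig x)|apply H, HP].
Qed.

Lemma defin_restrict1 (P : W -> Prop) : defin (fun ρ => P (ρ 0)) ->
  exists Q, dfn1 E Q /\ (forall x, Q (val x) <-> P x) /\ (forall x, Q x -> in_W E x).
Proof.
  intros HP. destruct (defin_bind (fun _ => P) HP) as (Q & HQ & H).
  (* Some element must fill the remaining positions of the assignment; if W is empty, the empty
     predicate serves. *)
  destruct (classic (exists d : W, True)) as [[d _]|Hn].
  - exists (fun x => in_W E x /\ Q (fun _ => val d) x). split; [|split].
    + apply dfn_and; [apply (dfn_in_W E ZF), tm_var|].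
      apply (dfn_subst E (fun ρ => Q (fun k => ρ (S k)) (ρ 0))
        ((fun ρ => ρ 0) .: fun _ _ => val d) HQ).
      intros [|k]; [apply tm_var|apply tm_const].
    + intro x. rewrite (H (fun _ => d)). split; [tauto|]. intro. split; auto.
      exact (proj2_sig x).
    + tauto.
  - exists (fun _ => False). split; [apply dfn_False|]. split; [|tauto].
    intro x. destruct Hn. eauto.
Qed.

Lemma defin_restrict2 (R : W -> W -> Prop) : defin (fun ρ => R (ρ 0) (ρ 1)) ->
  exists Q, dfn2 E Q /\ (forall x y, Q (val x) (val y) <-> R x y) /\
    (forall x y, Q x y -> in_W E x /\ in_W E y).
Proof.
  intros (Q & HQ & H).
  (* The second argument also fills the remaining positions. *)
  exists (fun x y => in_W E x /\ in_W E y /\ Q (x .: fun _ => y)). split; [|split].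
  - apply dfn_and; [apply (dfn_in_W E ZF), tm_var|].
    apply dfn_and; [apply (dfn_in_W E ZF), tm_var|].
    replace (fun ρ => Q (ρ 0 .: fun _ => ρ 1))
      with (fun ρ : nat -> M => Q (fun k => ((fun ρ => ρ 0) .: fun _ ρ => ρ 1) k ρ)).
    + apply dfn_subst; auto. intros [|k]; apply tm_var.
    + extensionality ρ. f_equal. extensionality k. destruct k; reflexivity.
  - intros x y. rewrite <- (H (x .: fun _ => y)), <- scons_val.
    pose proof (proj2_sig x). pose proof (proj2_sig y). tauto.
  - tauto.
Qed.

(** * Elements of W as pairs of small classes *)

Lemma W_pair (x : W) : exists p q, is_pair E (val x) p q /\
  (forall y, y ∈ p -> in_W E y) /\ (forall y, y ∈ q -> in_W E y).
Proof. apply (in_W_iff E ZF). exact (proj2_sig x). Qed.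

Lemma inT_iff x y p q : is_pair E (val x) p q -> inT y x <-> val y ∈ p.
Proof.
  intro H. split; [|intro; exists p, q; auto].
  intros (a & b & H' & Hy). destruct (pair_inj E _ _ _ _ _ H H') as [-> _]. exact Hy.
Qed.

Lemma inF_iff x y p q : is_pair E (val x) p q -> inF y x <-> ~ val y ∈ q.
Proof.
  intro H. split; [|intro; exists p, q; auto].
  intros (a & b & H' & Hy). destruct (pair_inj E _ _ _ _ _ H H') as [_ ->]. exact Hy.
Qed.

(** The components contain elements of W only, so their traces on W determine them as sets. *)
Lemma W_ext x y : (forall z, inT z x <-> inT z y) -> (forall z, inF z x <-> inF z y) -> x = y.
Proof.
  intros HT HF. destruct (W_pair x) as (p & q & Hx & Hp & Hq).
  destruct (W_pair y) as (p' & q' & Hy & Hp' & Hq').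
  apply val_inj, (pair_fun E ZF _ _ p q Hx).
  replace p with p'; [replace q with q'; [exact Hy|]|]; apply (set_ext E ZF); intro z.
  - split; intro Hz; apply NNPP; intro Hn.
    + set (d := exist _ z (Hq' z Hz) : W). apply (inF_iff x d p q Hx) in Hn.
      apply HF, (inF_iff y d _ _ Hy) in Hn. auto.
    + set (d := exist _ z (Hq z Hz) : W). apply (inF_iff y d _ _ Hy) in Hn.
      apply HF, (inF_iff x d _ _ Hx) in Hn. auto.
  - split; intro Hz.
    + set (d := exist _ z (Hp' z Hz) : W). apply (inT_iff x d p q Hx), HT, (inT_iff y d p' q' Hy), Hz.
    + set (d := exist _ z (Hp z Hz) : W). apply (inT_iff y d p' q' Hy), HT, (inT_iff x d p q Hx), Hz.
Qed.

Lemma small_W P : small P -> exists a, (forall d, val d ∈ a <-> P d) /\ forall x, x ∈ a -> in_W E x.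
Proof.
  intros [a Ha]. destruct (sep E ZF (in_W E)) with (u := a) as [s Hs].
  { apply (dfn_in_W E ZF), tm_var. }
  exists s. split; [|intros x Hx; apply Hs; exact Hx].
  intro d. rewrite Hs, <- Ha. pose proof (proj2_sig d). tauto.
Qed.

(* P is the positive extension and Q the complement of the negative one. *)
Lemma W_make P Q : small P -> small Q ->
  exists x, forall z, (inT z x <-> P z) /\ (inF z x <-> ~ Q z).
Proof.
  intros (p & HP & Wp)%small_W (q & HQ & Wq)%small_W.
  destruct (pair_ex E ZF p q) as [x Hx].
  assert (HW : in_W E x). { apply (in_W_iff E ZF). exists p, q. auto. }
  exists (exist _ x HW). intro z. rewrite (inT_iff (exist _ x HW) z p q Hx), HP.
  rewrite (inF_iff (exist _ x HW) z p q Hx), HQ. tauto.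
Qed.

Lemma small_ext P Q : small P -> (forall x, P x <-> Q x) -> small Q.
Proof. intros [a Ha] H. exists a. intro d. rewrite Ha. apply H. Qed.

Lemma small_T x : small (fun z => inT z x).
Proof.
  destruct (W_pair x) as (p & q & Hx & _). exists p. intro d.
  rewrite (inT_iff x d p q Hx). reflexivity.
Qed.

(** Only the complement of the negative extension is a set, which is why [~ inF] occurs
    throughout. *)
Lemma small_F x : small (fun z => ~ inF z x).
Proof.
  destruct (W_pair x) as (p & q & Hx & _). exists q. intro d.
  rewrite (inF_iff x d p q Hx). split; [tauto|apply NNPP].
Qed.

Lemma small_sep P Q : small P -> defin (fun ρ => Q (ρ 0)) -> small (fun z => P z /\ Q z).
Proof.
  intros [a Ha] HQ. destruct (defin_restrict1 Q HQ) as (R & HR & H & _).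
  destruct (sep E ZF R HR a) as [s Hs]. exists s. intro d. rewrite Hs, Ha, H. reflexivity.
Qed.

Lemma small_image P R : small P -> defin (fun ρ => R (ρ 0) (ρ 1)) ->
  (forall x y z, R x y -> R x z -> y = z) -> small (fun z => exists w, P w /\ R w z).
Proof.
  intros (a & Ha & Wa)%small_W HR Hf. destruct (defin_restrict2 R HR) as (Q & HQ & H & WQ).
  destruct (replacement E ZF Q HQ) with (u := a) as [s Hs].
  { intros x y z [H1 H2]. destruct (WQ _ _ H1) as [Wx Wy], (WQ _ _ H2) as [_ Wz].
    apply (H (exist _ x Wx) (exist _ y Wy)) in H1. apply (H (exist _ x Wx) (exist _ z Wz)) in H2.
    injection (Hf _ _ _ H1 H2). auto. }
  exists s. intro d. rewrite Hs. split.
  - intros (w & Hw & Hr). exists (exist _ w (Wa w Hw)). split; [apply Ha, Hw|apply H, Hr].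
  - intros (w & Hw & Hr). exists (val w). rewrite Ha, H. auto.
Qed.

Lemma small_empty (x : W) : small (fun _ => False).
Proof.
  destruct (empty_ex E ZF (val x)) as [s Hs]. exists s. intro d. specialize (Hs (val d)). tauto.
Qed.

Lemma small_eq u : small (fun z => z = u).
Proof.
  destruct (sing_ex E ZF (val u)) as [s Hs]. exists s. intro d. rewrite Hs.
  split; [apply val_inj|congruence].
Qed.

Lemma small_or P Q : small P -> small Q -> small (fun z => P z \/ Q z).
Proof.
  intros [a Ha] [b Hb]. destruct (cup_ex E ZF a b) as [s Hs]. exists s. intro d.
  rewrite Hs, Ha, Hb. reflexivity.
Qed.

(** Replacement is applied to the map from [y] to the set of all [z] with [R z y]. Confining [Q] to
    W makes that set unique. *)
Lemma small_union P (R : W -> W -> Prop) : small P -> defin (fun ρ => R (ρ 0) (ρ 1)) ->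
  (forall y, small (fun z => R z y)) -> small (fun z => exists y, P y /\ R z y).
Proof.
  intros (a & Ha & Wa)%small_W HR Hs. destruct (defin_restrict2 R HR) as (Q & HQ & H & WQ).
  destruct (replacement E ZF (fun y s => forall z, z ∈ s <-> Q z y)) with (u := a) as [f Hf].
  { dfn. }
  { intros y s t [H1 H2]. apply (set_ext E ZF). intro z. rewrite H1, H2. reflexivity. }
  destruct (union_ex E ZF f) as [u Hu]. exists u. intro d. rewrite Hu. split.
  - intros (s & Hd & (y & Hy & Hys)%Hf). exists (exist _ y (Wa y Hy)).
    split; [apply Ha, Hy|]. apply H, Hys, Hd.
  - intros (y & Hy & Hd). destruct (small_W _ (Hs y)) as (s & Hsy & Ws).
    exists s. split; [apply Hsy, Hd|]. apply Hf. exists (val y). split; [apply Ha, Hy|].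
    intro z. split; intro Hz.
    + apply (H (exist _ z (Ws z Hz)) y), Hsy, Hz.
    + destruct (WQ _ _ Hz) as [Wz _]. apply (Hsy (exist _ z Wz)), H, Hz.
Qed.

Ltac defin_step :=
  cbv beta;
  first
    [ assumption
    | apply dtm_var | apply dtm_const
    | apply defin_and | apply defin_or | apply defin_iff | apply defin_all
    | apply defin_imp | apply defin_not | apply defin_ex
    | apply defin_eq | apply defin_inT | apply defin_inF | apply defin_False | apply defin_True
    | apply defin_app2; [assumption| |] | apply defin_app1; [assumption|] ].
Ltac defin := repeat defin_step.

(** For [x] = (p, q) and [u] = (a, b) the condition says p ⊆ a and q ⊆ b, so [x] is a pair of
    subsets of a ∪ b. *)
Lemma small_power u :
  small (fun x => (forall z, inT z x -> inT z u) /\ (forall z, inF z u -> inF z x)).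
Proof.
  destruct (W_pair u) as (a & b & Hu & _). destruct (cup_ex E ZF a b) as [c Hc].
  destruct (step_ex E ZF c) as [w Hw].
  apply (small_ext (fun x => val x ∈ w /\
    ((forall z, inT z x -> inT z u) /\ (forall z, inF z u -> inF z x)))).
  - apply small_sep; [exists w; reflexivity|defin].
  - intro x. split; [tauto|]. intros [HT HF]. split; [|auto].
    destruct (W_pair x) as (p & q & Hx & Hp & Hq). apply Hw. exists p, q.
    split; [exact Hx|]. split; intros z Hz; apply Hc.
    + left. set (d := exist _ z (Hp z Hz) : W).
      apply (inT_iff u d a b Hu), HT, (inT_iff x d p q Hx), Hz.
    + right. set (d := exist _ z (Hq z Hz) : W). apply NNPP. intro Hn.
      apply (inF_iff u d a b Hu), HF, (inF_iff x d p q Hx) in Hn. auto.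
Qed.

(** [inT y x \/ ~ inF y x] says that [y] lies in one of the two components of [x]. *)
Lemma W_ind (P : W -> Prop) : defin (fun ρ => P (ρ 0)) ->
  (forall x, (forall y, inT y x \/ ~ inF y x -> P y) -> P x) -> forall x, P x.
Proof.
  intros HP IH x. destruct (defin_restrict1 P HP) as (Q & HQ & H & WQ).
  apply H. apply (in_W_ind E ZF Q HQ); [|exact (proj2_sig x)].
  clear x. intros x p q Wx Hx Hp Hq. apply (H (exist _ x Wx)), IH. intros y Hy.
  apply H. destruct Hy as [Hy|Hy].
  - apply Hp. apply (inT_iff (exist _ x Wx) y p q Hx), Hy.
  - apply Hq. apply NNPP. intro Hn. apply Hy, (inF_iff (exist _ x Wx) y p q Hx), Hn.
Qed.

Lemma W_inductive (x0 : M) : exists P, small P /\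
  (forall e, (forall z, ~ inT z e /\ inF z e) -> P e) /\
  (forall x y, P x -> (forall z, inT z y <-> inT z x \/ z = x) ->
    (forall z, inF z y <-> inF z x /\ z <> x) -> P y).
Proof.
  destruct (inductive_ex E ZF x0) as (s & Ws & He & Hs).
  exists (fun x => val x ∈ s). split; [exists s; reflexivity|]. split.
  - intros e H. destruct (W_pair e) as (p & q & Hp & Wp & Wq).
    assert (Hep : empty E p).
    { intros z Hz. apply (H (exist _ z (Wp z Hz))). apply (inT_iff e _ p q Hp), Hz. }
    assert (Heq : empty E q).
    { intros z Hz. apply (inF_iff e (exist _ z (Wq z Hz)) p q Hp); [apply H|exact Hz]. }
    apply (He (val e) p Hep). replace q with p in Hp; [exact Hp|].
    apply (set_ext E ZF). intro z. pose proof (Hep z). pose proof (Heq z). tauto.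
  - intros x y Hx HT HF. destruct (W_pair x) as (p & q & Hxp & _).
    destruct (W_pair y) as (p' & q' & Hyp & Wp & Wq).
    apply (Hs (val x) (val y) p q p' q' Hx Hxp Hyp); intros z Hz.
    + set (d := exist _ z (Wp z Hz) : W).
      destruct (proj1 (HT d) (proj2 (inT_iff y d _ _ Hyp) Hz)) as [Hd|Hd].
      * left. exact (proj1 (inT_iff x d p q Hxp) Hd).
      * right. exact (f_equal val Hd).
    + set (d := exist _ z (Wq z Hz) : W). apply NNPP. intros [Hn1 Hn2]%not_or_and.
      apply (inF_iff y d p' q' Hyp); [|exact Hz]. apply HF. split.
      * apply (inF_iff x d p q Hxp). exact Hn1.
      * intro Heq. apply Hn2. exact (f_equal val Heq).
Qed.

(** Choice in [M] is applied to the set of first components, the only part that [inT] sees; elements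
    with equal positive extensions get the same choice. *)
Lemma W_choice P : small P -> (forall x, P x -> exists y, inT y x) ->
  exists C : W -> W -> Prop, defin (fun ρ => C (ρ 0) (ρ 1)) /\
    (forall x y z, C x y -> C x z -> y = z) /\
    (forall x, P x -> exists y, C x y /\ inT y x).
Proof.
  intros (a & Ha & Wa)%small_W Hne.
  destruct (replacement E ZF (fun x p => exists q, is_pair E x p q)) with (u := a) as [u Hu].
  { dfn. }
  { intros x p p' [[q Hq] [q' Hq']]. apply (pair_inj E _ _ _ _ _ Hq Hq'). }
  destruct (choice_ex E ZF u) as (f & Hf & Hc).
  { intros p (x & Hx & q & Hp)%Hu. destruct (Hne (exist _ x (Wa x Hx))) as [y Hy].
    - apply Ha, Hx.
    - exists (val y). apply (inT_iff (exist _ x (Wa x Hx)) y p q Hp), Hy. }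
  exists (fun x y => exists p q, is_pair E (val x) p q /\ app E f p (val y)).
  split; [|split].
  - exists (fun ρ => exists p q, is_pair E (ρ 0) p q /\ app E f p (ρ 1)).
    split; [dfn|reflexivity].
  - intros x y z (p & q & Hp & Hy) (p' & q' & Hp' & Hz).
    destruct (pair_inj E _ _ _ _ _ Hp Hp') as [<- _].
    apply val_inj. apply (proj2 (proj2 Hf) p). auto.
  - intros x Hx. destruct (W_pair x) as (p & q & Hp & Wp & _).
    destruct (Hc p) as (y & Hy & Hyp). { apply Hu. exists (val x). split; [apply Ha, Hx|eauto]. }
    exists (exist _ y (Wp y Hyp)). split; [exists p, q; auto|].
    apply (inT_iff x _ p q Hp), Hyp.
Qed.

(** * Evaluation of BS4 formulas *)

(* The special clause for the falsity of φ → ⊥ drops a trivial conjunct; with it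
   !φ and ?φ evaluate to [evT φ] and [~ evF φ] by conversion. *)
Fixpoint evT (ρ : nat -> W) (φ : bs4) : Prop :=
  match φ with
  | bIn x y => inT (ρ x) (ρ y)
  | bEq x y => ρ x = ρ y
  | bBot => False
  | bNeg φ => evF ρ φ
  | bAnd φ ψ => evT ρ φ /\ evT ρ ψ
  | bOr φ ψ => evT ρ φ \/ evT ρ ψ
  | bImp φ ψ => evT ρ φ -> evT ρ ψ
  | bAll φ => forall x, evT (x .: ρ) φ
  | bEx φ => exists x, evT (x .: ρ) φ
  end
with evF (ρ : nat -> W) (φ : bs4) : Prop :=
  match φ with
  | bIn x y => inF (ρ x) (ρ y)
  | bEq x y => eqF (ρ x) (ρ y)
  | bBot => True
  | bNeg φ => evT ρ φ
  | bAnd φ ψ => evF ρ φ \/ evF ρ ψ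
  | bOr φ ψ => evF ρ φ /\ evF ρ ψ
  | bImp φ bBot => evT ρ φ
  | bImp φ ψ => evT ρ φ /\ evF ρ ψ
  | bAll φ => exists x, evF (x .: ρ) φ
  | bEx φ => forall x, evF (x .: ρ) φ
  end.

Lemma evF_imp ρ φ ψ : evF ρ (bImp φ ψ) <-> evT ρ φ /\ evF ρ ψ.
Proof. destruct ψ; cbn; tauto. Qed.

Lemma sat_all_W (P : M -> Prop) (Q : W -> Prop) : (forall x, P (val x) <-> Q x) ->
  (forall x, in_W E x -> P x) <-> (forall x, Q x).
Proof.
  intro H. split.
  - intros HP x. apply H, HP. exact (proj2_sig x).
  - intros HQ x Hx. apply (H (exist _ x Hx)), HQ.
Qed.

Lemma sat_ex_W (P : M -> Prop) (Q : W -> Prop) : (forall x, P (val x) <-> Q x) ->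
  (exists x, in_W E x /\ P x) <-> (exists x, Q x).
Proof.
  intro H. split.
  - intros (x & Hx & HP). exists (exist _ x Hx). apply H, HP.
  - intros [x HQ]. exists (val x). split; [exact (proj2_sig x)|apply H, HQ].
Qed.

Lemma scons_below (x : W) n ρ σ : (forall k, k < n -> ρ k = val (σ k)) ->
  forall k, k < S n -> (val x .: ρ) k = val ((x .: σ) k).
Proof. intros H [|k] Hk; cbn; auto with arith. Qed.

(** Agreement is required only below [n], because an assignment into [M] may leave W at the other
    variables. *)
Lemma sat_ev φ : forall n ρ σ, b_closed n φ -> (forall k, k < n -> ρ k = val (σ k)) ->
  (sat E ρ (trT φ) <-> evT σ φ) /\ (sat E ρ (trF φ) <-> evF σ φ).
Proof.
  induction φ; cbn [b_closed]; intros n ρ σ Hc H.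
  - change (sat E ρ (trT (bIn x y))) with
      (exists a b, is_pair E (ρ y) a b /\ ρ x ∈ a).
    change (sat E ρ (trF (bIn x y))) with
      (exists a b, is_pair E (ρ y) a b /\ ~ ρ x ∈ b).
    rewrite !H by tauto. split; reflexivity.
  - change (sat E ρ (trF (bEq x y))) with (exists a b c d,
      is_pair E (ρ x) a b /\ is_pair E (ρ y) c d /\
      ((exists z, z ∈ a /\ ~ z ∈ d) \/ (exists z, z ∈ c /\ ~ z ∈ b))).
    cbn. rewrite !H by tauto. split; [|reflexivity].
    split; [apply val_inj|congruence].
  - cbn. tauto.
  - destruct (IHφ n ρ σ Hc H). cbn. tauto.
  - destruct (IHφ1 n ρ σ), (IHφ2 n ρ σ); try tauto. cbn. tauto.
  - destruct (IHφ1 n ρ σ), (IHφ2 n ρ σ); try tauto. cbn. tauto.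
  - destruct (IHφ1 n ρ σ), (IHφ2 n ρ σ); try tauto. rewrite evF_imp. cbn. tauto.
  - pose proof (fun x => IHφ (S n) _ _ Hc (scons_below x n ρ σ H)) as IH. split.
    + refine (iff_trans _ (sat_all_W (fun x => sat E (x .: ρ) (trT φ)) _ (fun x => proj1 (IH x)))).
      split; intros Hs x Hx; apply Hs, (sat_in_W E ZF (x .: ρ) 0), Hx.
    + refine (iff_trans _ (sat_ex_W (fun x => sat E (x .: ρ) (trF φ)) _ (fun x => proj2 (IH x)))).
      split; intros (x & Hx & Hs); exists x; (split; [|exact Hs]);
        apply (sat_in_W E ZF (x .: ρ) 0), Hx.
  - pose proof (fun x => IHφ (S n) _ _ Hc (scons_below x n ρ σ H)) as IH. split.
    + refine (iff_trans _ (sat_ex_W (fun x => sat E (x .: ρ) (trT φ)) _ (fun x => proj1 (IH x)))).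
      split; intros (x & Hx & Hs); exists x; (split; [|exact Hs]);
        apply (sat_in_W E ZF (x .: ρ) 0), Hx.
    + refine (iff_trans _ (sat_all_W (fun x => sat E (x .: ρ) (trF φ)) _ (fun x => proj2 (IH x)))).
      split; intros Hs x Hx; apply Hs, (sat_in_W E ZF (x .: ρ) 0), Hx.
Qed.

Lemma ev_ren φ : forall r ρ σ, (forall k, ρ (r k) = σ k) ->
  (evT ρ (b_ren r φ) <-> evT σ φ) /\ (evF ρ (b_ren r φ) <-> evF σ φ).
Proof.
  induction φ; intros r ρ σ H; cbn [b_ren]; rewrite ?evF_imp; cbn [evT evF]; rewrite ?H;
    try (destruct (IHφ1 r ρ σ H), (IHφ2 r ρ σ H)); try tauto.
  - destruct (IHφ r ρ σ H). tauto.
  - assert (Hup : forall x k, (x .: ρ) (up r k) = (x .: σ) k) by (intros x [|k]; cbn; auto).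
    pose proof (fun x => IHφ (up r) _ _ (Hup x)) as IH. split; split.
    + intros Hs x. apply IH, Hs.
    + intros Hs x. apply IH, Hs.
    + intros [x Hs]. exists x. apply IH, Hs.
    + intros [x Hs]. exists x. apply IH, Hs.
  - assert (Hup : forall x k, (x .: ρ) (up r k) = (x .: σ) k) by (intros x [|k]; cbn; auto).
    pose proof (fun x => IHφ (up r) _ _ (Hup x)) as IH. split; split.
    + intros [x Hs]. exists x. apply IH, Hs.
    + intros [x Hs]. exists x. apply IH, Hs.
    + intros Hs x. apply IH, Hs.
    + intros Hs x. apply IH, Hs.
Qed.

Lemma evT_ren φ r ρ σ : (forall k, ρ (r k) = σ k) -> evT ρ (b_ren r φ) <-> evT σ φ.
Proof. apply ev_ren. Qed.

Lemma evF_ren φ r ρ σ : (forall k, ρ (r k) = σ k) -> evF ρ (b_ren r φ) <-> evF σ φ.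
Proof. apply ev_ren. Qed.

Lemma b_closed_mono φ : forall m n, b_closed m φ -> m <= n -> b_closed n φ.
Proof.
  induction φ; cbn; intros m n Hc H; try tauto; try lia;
    try (destruct Hc; eauto); eapply IHφ; eauto; lia.
Qed.

Lemma b_closed_ex φ : exists n, b_closed n φ.
Proof.
  induction φ;
    try (destruct IHφ1 as [m Hm], IHφ2 as [n Hn]; exists (m + n);
         split; eapply b_closed_mono; eauto; lia);
    try (destruct IHφ as [n Hn]; exists n; cbn; eapply b_closed_mono; eauto; lia).
  - exists (S (x + y)). cbn. lia.
  - exists (S (x + y)). cbn. lia.
  - exists 0. exact I.
Qed.

(** Lets BS4 formulas enter Separation, Replacement and induction in [M]: their translations are the
    defining formulas. *)
Lemma defin_ev φ (e : (nat -> W) -> nat -> W) : (forall k, dtm (fun ρ => e ρ k)) ->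
  defin (fun ρ => evT (e ρ) φ) /\ defin (fun ρ => evF (e ρ) φ).
Proof.
  intro He. destruct (b_closed_ex φ) as [n Hn].
  assert (H : forall ρ, (sat E (fun k => val (ρ k)) (trT φ) <-> evT ρ φ) /\
    (sat E (fun k => val (ρ k)) (trF φ) <-> evF ρ φ)).
  { intro ρ. apply (sat_ev φ n); auto. }
  split.
  - apply (defin_subst (fun ρ => evT ρ φ) (fun k ρ => e ρ k)); auto.
    exists (fun ρ => sat E ρ (trT φ)). split; [|apply H].
    apply (dfn_sat E _ (fun k ρ => ρ k)). intro. apply tm_var.
  - apply (defin_subst (fun ρ => evF ρ φ) (fun k ρ => e ρ k)); auto.
    exists (fun ρ => sat E ρ (trF φ)). split; [|apply H].
    apply (dfn_sat E _ (fun k ρ => ρ k)). intro. apply tm_var.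
Qed.

Lemma defin_evT φ (e : (nat -> W) -> nat -> W) :
  (forall k, dtm (fun ρ => e ρ k)) -> defin (fun ρ => evT (e ρ) φ).
Proof. apply defin_ev. Qed.

Lemma defin_evF φ (e : (nat -> W) -> nat -> W) :
  (forall k, dtm (fun ρ => e ρ k)) -> defin (fun ρ => evF (e ρ) φ).
Proof. apply defin_ev. Qed.

Ltac defin_ev :=
  first [apply defin_evT | apply defin_evF];
  intros [|[|k]]; cbn [scons]; (apply dtm_var || apply dtm_const).

(** * The axioms *)

(** An element of a \ d is truly in [x] and falsely in [y]. In this form [=^-] matches the falsity
    of ∀z(z ∈ x ⇔ z ∈ y). *)
Lemma eqF_iff x y : eqF x y <-> exists z, (inT z x /\ inF z y) \/ (inT z y /\ inF z x).
Proof.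
  destruct (W_pair x) as (a & b & Hx & Wa & _), (W_pair y) as (c & d & Hy & Wc & _). split.
  - intros (a' & b' & c' & d' & Hx' & Hy' & H).
    destruct (pair_inj E _ _ _ _ _ Hx Hx') as [<- <-], (pair_inj E _ _ _ _ _ Hy Hy') as [<- <-].
    destruct H as [(z & Hz & Hn)|(z & Hz & Hn)].
    + exists (exist _ z (Wa z Hz)). left. split; [exists a, b|exists c, d]; auto.
    + exists (exist _ z (Wc z Hz)). right. split; [exists c, d|exists a, b]; auto.
  - intros [z H]. exists a, b, c, d. split; [exact Hx|]. split; [exact Hy|].
    rewrite (inT_iff x z a b Hx), (inT_iff y z c d Hy), (inF_iff x z a b Hx), (inF_iff y z c d Hy) in H.
    destruct H; [left|right]; exists (val z); exact H.
Qed.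

Lemma holds_extensionality σ : evT σ bz_extensionality.
Proof.
  intros x y.
  (* Here and below [change] displays the value of the axiom, reached by conversion. Each of the
     four implications in the inner [⇔] contributes a disjunct to its falsity. *)
  change ((x = y <-> forall z, (inT z x <-> inT z y) /\ (inF z x <-> inF z y)) /\
    (eqF x y <-> exists z,
      ((inT z x /\ inF z y) \/ (inT z y /\ inF z x)) \/
      ((inF z x /\ inT z y) \/ (inF z y /\ inT z x)))).
  split.
  - split; [intros ->; split; reflexivity|]. intro H. apply W_ext; apply H.
  - rewrite eqF_iff. split; intros [z Hz]; exists z; tauto.
Qed.

Lemma holds_comprehension φ σ : evT σ (bz_comprehension φ).
Proof.
  intro u.
  (* A conjunction is false once one conjunct is, so the second component is that of [u] separated
     by [~ evF φ]. *)
  destruct (W_make (fun y => inT y u /\ evT (y .: u .: σ) φ)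
    (fun y => ~ inF y u /\ ~ evF (y .: u .: σ) φ)) as [x Hx].
  { apply small_sep; [apply small_T|]. defin_ev. }
  { apply small_sep; [apply small_F|]. apply defin_not. defin_ev. }
  exists x. intro y. destruct (Hx y) as [H1 H2].
  assert (Hr : forall k, (y .: x .: u .: σ) (at1 0 2 k) = (y .: u .: σ) k).
  { intros [|k]; cbn; [|rewrite Nat.add_comm]; reflexivity. }
  change ((inT y x <-> inT y u /\ evT (y .: x .: u .: σ) (b_ren (at1 0 2) φ)) /\
    (inF y x <-> inF y u \/ evF (y .: x .: u .: σ) (b_ren (at1 0 2) φ))).
  rewrite H1, H2, (evT_ren _ _ _ _ Hr), (evF_ren _ _ _ _ Hr). split; [reflexivity|tauto].
Qed.

Lemma holds_classical_superset σ : evT σ bz_classical_superset.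
Proof.
  intro x.
  (* Both components of the superset are the union of the two components of [x]; equal components
     make it classical. *)
  assert (Hs : small (fun y => inT y x \/ ~ inF y x)) by (apply small_or; [apply small_T|apply small_F]).
  destruct (W_make _ _ Hs Hs) as [c Hc]. exists c.
  change ((forall y, (inT y x -> inT y c) /\ (inF y c -> inF y x)) /\
    forall y, inT y c <-> ~ inF y c).
  split; intro y; destruct (Hc y) as [H1 H2]; rewrite H1, H2; tauto.
Qed.

(** Classicality identifies [~ evF φ] with [evT φ], so the image of the second component is again
    taken along a functional relation. *)
Lemma holds_replacement φ σ : evT σ (bz_replacement φ).
Proof.
  intros [Hcl Hfun] u.
  assert (Hat : forall i j d ρ x y, (forall k, ρ (d + k) = σ k) -> ρ i = x -> ρ j = y ->
    forall k, ρ (at2 i j d k) = (x .: y .: σ) k).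
  { intros i j d ρ x y H <- <- [|[|k]]; cbn; auto. rewrite Nat.add_comm. apply H. }
  assert (Hφ : forall x y, evT (x .: y .: σ) φ <-> ~ evF (x .: y .: σ) φ).
  { intros x y. pose proof (Hcl x y) as H.
    change (evT (y .: x .: σ) (b_ren (at2 1 0 2) φ) <->
      ~ evF (y .: x .: σ) (b_ren (at2 1 0 2) φ)) in H.
    rewrite evT_ren in H by (apply Hat; reflexivity).
    rewrite evF_ren in H by (apply Hat; reflexivity). exact H. }
  assert (HR : forall x y z, evT (x .: y .: σ) φ -> evT (x .: z .: σ) φ -> y = z).
  { intros x y z Hy Hz. destruct (Hfun x) as (t & _ & Ht).
    assert (Hu : forall z, evT (x .: z .: σ) φ -> t = z).
    { intros z' Hz'. apply (Ht z'). refine (proj2 (evT_ren _ _ _ _ _) Hz').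
      apply Hat; reflexivity. }
    rewrite <- (Hu y Hy). apply Hu, Hz. }
  assert (Hd : defin (fun ρ => evT (ρ 0 .: ρ 1 .: σ) φ)) by defin_ev.
  destruct (W_make (fun z => exists w, inT w u /\ evT (w .: z .: σ) φ)
    (fun z => exists w, ~ inF w u /\ evT (w .: z .: σ) φ)) as [y Hy].
  { exact (small_image _ (fun w z => evT (w .: z .: σ) φ) (small_T u) Hd HR). }
  { exact (small_image _ (fun w z => evT (w .: z .: σ) φ) (small_F u) Hd HR). }
  exists y. intro z. destruct (Hy z) as [H1 H2].
  assert (Hr : forall w k, (w .: z .: y .: u .: σ) (at2 0 1 4 k) = (w .: z .: σ) k).
  { intro w. apply Hat; reflexivity. }
  change ((inT z y <-> exists w, inT w u /\ evT (w .: z .: y .: u .: σ) (b_ren (at2 0 1 4) φ)) /\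
    (inF z y <-> forall w, inF w u \/ evF (w .: z .: y .: u .: σ) (b_ren (at2 0 1 4) φ))).
  rewrite H1, H2. split.
  - split; intros (w & Hw & H); exists w; (split; [exact Hw|]);
      apply (evT_ren _ _ _ _ (Hr w)), H.
  - split.
    + intros Hn w. rewrite (evF_ren _ _ _ _ (Hr w)). apply NNPP. intros [Hw Hf]%not_or_and.
      apply Hn. exists w. split; [exact Hw|apply Hφ, Hf].
    + intros H (w & Hw & Ht). specialize (H w). rewrite (evF_ren _ _ _ _ (Hr w)) in H.
      apply Hφ in Ht. tauto.
Qed.

Lemma holds_pairing σ : evT σ bz_pairing.
Proof.
  intros u v.
  assert (Hs : small (fun z => z = u \/ z = v)) by (apply small_or; apply small_eq).
  destruct (W_make _ _ Hs Hs) as [x Hx]. exists x. intro z. destruct (Hx z) as [H1 H2].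
  change ((inT z x <-> z = u \/ z = v) /\ (inF z x <-> ~ z = u /\ ~ z = v)).
  rewrite H1, H2. tauto.
Qed.

Lemma holds_power σ : evT σ bz_power.
Proof.
  (* The defining condition stands under [!], which is false exactly when not true; hence the same
     class twice. *)
  intro u. destruct (W_make _ _ (small_power u) (small_power u)) as [v Hv].
  exists v. intro x. destruct (Hv x) as [H1 H2].
  set (P := forall z, (inT z x -> inT z u) /\ (inF z u -> inF z x)).
  change ((inT x v <-> P) /\ (inF x v <-> ~ P)). rewrite H1, H2. unfold P.
  split; [|apply not_iff_compat]; (split; [intros [? ?] z; auto|intro H; split; apply H]).
Qed.

Lemma holds_union σ : evT σ bz_union.
Proof.
  intro u.
  destruct (W_make (fun z => exists y, inT y u /\ inT z y)
    (fun z => exists y, ~ inF y u /\ ~ inF z y)) as [x Hx].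
  { apply small_union; [apply small_T|defin|apply small_T]. }
  { apply (small_union _ (fun z y => ~ inF z y)); [apply small_F|defin|apply small_F]. }
  exists x. intro z. destruct (Hx z) as [H1 H2].
  change ((inT z x <-> exists y, inT z y /\ inT y u) /\
    (inF z x <-> forall y, inF z y \/ inF y u)).
  rewrite H1, H2. split.
  - split; intros (y & ? & ?); exists y; auto.
  - split.
    + intros Hn y. apply NNPP. intros [? ?]%not_or_and. apply Hn. eauto.
    + intros H (y & Hu & Hz). destruct (H y); auto.
Qed.

Lemma holds_foundation φ σ : evT σ (bz_foundation φ).
Proof.
  intro H.
  assert (Hr : forall u k, (u .: σ) (at1 0 1 k) = (u .: σ) k).
  { intros u [|k]; cbn; [|rewrite Nat.add_comm]; reflexivity. }
  assert (Hall : forall u, evT (u .: σ) φ).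
  { apply W_ind; [defin_ev|]. intros x IH. apply (evT_ren _ _ _ _ (Hr x)), H.
    intros y Hy. apply (evT_ren _ _ _ (y .: σ)); [|exact (IH y Hy)].
    intros [|k]; cbn; [|rewrite Nat.add_comm]; reflexivity. }
  intro u. apply (evT_ren _ _ _ _ (Hr u)), Hall.
Qed.

Lemma holds_infinity σ : evT σ bz_infinity.
Proof.
  destruct (W_inductive (val (σ 0))) as (P & HP & He & Hs).
  destruct (W_make _ _ HP HP) as [x Hx]. exists x. split.
  - destruct (W_make _ _ (small_empty x) (small_empty x)) as [e Hemp]. exists e.
    change ((forall z, (inT z e <-> False) /\ (inF z e <-> True)) /\ inT e x).
    split.
    + intro z. destruct (Hemp z). tauto.
    + apply Hx, He. intro z. destruct (Hemp z). tauto.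
  - intros y Hy. apply Hx in Hy.
    destruct (W_make (fun z => inT z y \/ z = y) (fun z => ~ inF z y \/ z = y)) as [s Hsy].
    { apply small_or; [apply small_T|apply small_eq]. }
    { apply small_or; [apply small_F|apply small_eq]. }
    exists s.
    change ((forall z, (inT z s <-> inT z y \/ z = y) /\ (inF z s <-> inF z y /\ ~ z = y)) /\
      inT s x).
    assert (HT : forall z, inT z s <-> inT z y \/ z = y) by apply Hsy.
    assert (HF : forall z, inF z s <-> inF z y /\ ~ z = y).
    { intro z. rewrite (proj2 (Hsy z)). tauto. }
    split; [auto|]. apply Hx. exact (Hs y s Hy HT HF).
Qed.

Lemma holds_acla σ : evT σ bz_acla.
Proof.
  pose proof (small_empty (σ 0)) as H0.
  (* At [σ 0], membership in [a] is both true and false, and membership in [b] is neither. *)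
  destruct (W_make _ _ H0 (small_eq (σ 0))) as [b Hb], (W_make _ _ (small_eq (σ 0)) H0) as [a Ha].
  destruct (Ha (σ 0)) as [A1 A2], (Hb (σ 0)) as [B1 B2].
  split; [exists a|exists b]; exists (σ 0); left.
  - change (inT (σ 0) a /\ inF (σ 0) a). tauto.
  - change (~ inF (σ 0) b /\ ~ inT (σ 0) b). tauto.
Qed.

(** * Ordered pairs and Choice *)

(* Like [pr] below, these are the values of the corresponding BS4 macros. *)
Definition is_emp s := forall z, (inT z s <-> False) /\ (inF z s <-> True).
Definition is_sg s u := forall z, (inT z s <-> z = u) /\ (inF z s <-> ~ z = u).
Definition is_up s u v :=
  forall z, (inT z s <-> z = u \/ z = v) /\ (inF z s <-> ~ z = u /\ ~ z = v).
Definition kpair p u v := exists a b, is_sg a u /\ is_up b u v /\ is_up p a b.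
Definition tag0 z x := exists e, is_emp e /\ kpair z x e.
Definition tag1 z y := exists e s, is_emp e /\ is_sg s e /\ kpair z y s.
Definition pr p a b :=
  (forall z,
     (inT z p <-> (exists x, tag0 z x /\ inT x a) \/ (exists y, tag1 z y /\ inT y b)) /\
     (~ inT z p <-> (forall x, ~ tag0 z x \/ ~ inT x a) /\ (forall y, ~ tag1 z y \/ ~ inT y b)))
  /\ (forall z,
     (~ inF z p <-> (exists x, tag0 z x /\ ~ inF x a) \/ (exists y, tag1 z y /\ ~ inF y b)) /\
     (inF z p <-> (forall x, ~ tag0 z x \/ inF x a) /\ (forall y, ~ tag1 z y \/ inF y b))).

Lemma crisp P : small P -> exists x, forall z, (inT z x <-> P z) /\ (inF z x <-> ~ P z).
Proof. intro H. apply W_make; exact H. Qed.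

Lemma emp_ex (x : W) : exists e, is_emp e.
Proof. destruct (crisp _ (small_empty x)) as [e He]. exists e. intro z. destruct (He z). tauto. Qed.

Lemma sg_ex u : exists s, is_sg s u.
Proof. exact (crisp _ (small_eq u)). Qed.

Lemma up_ex u v : exists s, is_up s u v.
Proof.
  destruct (crisp _ (small_or _ _ (small_eq u) (small_eq v))) as [s Hs].
  exists s. intro z. destruct (Hs z). tauto.
Qed.

Lemma emp_fun s t : is_emp s -> is_emp t -> s = t.
Proof. intros H1 H2. apply W_ext; intro z; destruct (H1 z), (H2 z); tauto. Qed.

Lemma sg_fun s t u : is_sg s u -> is_sg t u -> s = t.
Proof. intros H1 H2. apply W_ext; intro z; destruct (H1 z), (H2 z); tauto. Qed.

Lemma up_fun s t u v : is_up s u v -> is_up t u v -> s = t.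
Proof. intros H1 H2. apply W_ext; intro z; destruct (H1 z), (H2 z); tauto. Qed.

Lemma kpair_ex u v : exists p, kpair p u v.
Proof.
  destruct (sg_ex u) as [a Ha], (up_ex u v) as [b Hb], (up_ex a b) as [p Hp].
  exists p, a, b. auto.
Qed.

Lemma kpair_fun p q u v : kpair p u v -> kpair q u v -> p = q.
Proof.
  intros (a & b & Ha & Hb & Hp) (a' & b' & Ha' & Hb' & Hq).
  rewrite (sg_fun _ _ _ Ha' Ha), (up_fun _ _ _ _ Hb' Hb) in Hq.
  exact (up_fun _ _ _ _ Hp Hq).
Qed.

(** Kuratowski's argument, carried out on positive extensions alone. *)
Lemma kpair_inj p u v u' v' : kpair p u v -> kpair p u' v' -> u = u' /\ v = v'.
Proof.
  assert (Hsg : forall s u, is_sg s u -> forall z, inT z s <-> z = u \/ z = u).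
  { intros s x H z. destruct (H z). tauto. }
  assert (Hinj : forall s u v u' v', (forall z, inT z s <-> z = u \/ z = v) ->
    (forall z, inT z s <-> z = u' \/ z = v') -> (u = u' /\ v = v') \/ (u = v' /\ v = u')).
  { intros s x y x' y' H1 H2. apply or_eq. intro z. rewrite <- H1. apply H2. }
  intros (a & b & Ha & Hb & Hp) (a' & b' & Ha' & Hb' & Hp').
  pose proof (Hsg _ _ Ha) as Ha1. pose proof (Hsg _ _ Ha') as Ha1'.
  assert (Hb1 : forall z, inT z b <-> z = u \/ z = v) by apply Hb.
  assert (Hb1' : forall z, inT z b' <-> z = u' \/ z = v') by apply Hb'.
  destruct (Hinj p a b a' b') as [[<- <-]|[<- <-]]; [apply Hp|apply Hp'| |].
  - destruct (Hinj _ _ _ _ _ Ha1 Ha1'), (Hinj _ _ _ _ _ Hb1 Hb1'); intuition congruence.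
  - destruct (Hinj _ _ _ _ _ Ha1 Hb1'), (Hinj _ _ _ _ _ Hb1 Ha1'); intuition congruence.
Qed.

Lemma tag0_fun x y z : tag0 y x -> tag0 z x -> y = z.
Proof.
  intros (e & He & Hy) (e' & He' & Hz). rewrite (emp_fun _ _ He' He) in Hz.
  exact (kpair_fun _ _ _ _ Hy Hz).
Qed.

Lemma tag1_fun x y z : tag1 y x -> tag1 z x -> y = z.
Proof.
  intros (e & s & He & Hs & Hy) (e' & s' & He' & Hs' & Hz). rewrite (emp_fun _ _ He' He) in Hs'.
  rewrite (sg_fun _ _ _ Hs' Hs) in Hz. exact (kpair_fun _ _ _ _ Hy Hz).
Qed.

Lemma tag0_ex x : exists z, tag0 z x.
Proof.
  destruct (emp_ex x) as [e He], (kpair_ex x e) as [z Hz]. exists z, e. auto.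
Qed.

Lemma tag1_ex x : exists z, tag1 z x.
Proof.
  destruct (emp_ex x) as [e He], (sg_ex e) as [s Hs], (kpair_ex x s) as [z Hz].
  exists z, e, s. auto.
Qed.

Lemma tag0_inj z x y : tag0 z x -> tag0 z y -> x = y.
Proof. intros (e & _ & Hx) (e' & _ & Hy). apply (kpair_inj _ _ _ _ _ Hx Hy). Qed.

Lemma tag1_inj z x y : tag1 z x -> tag1 z y -> x = y.
Proof. intros (e & s & _ & _ & Hx) (e' & s' & _ & _ & Hy). apply (kpair_inj _ _ _ _ _ Hx Hy). Qed.

(** A common value would identify ∅ with {∅}. *)
Lemma tag_disjoint z x y : tag0 z x -> tag1 z y -> False.
Proof.
  intros (e & He & Hx) (e' & s & He' & Hs & Hy).
  destruct (kpair_inj _ _ _ _ _ Hx Hy) as [_ ->].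
  apply (He e'). apply Hs. reflexivity.
Qed.

Lemma defin_tag0 : defin (fun ρ => tag0 (ρ 1) (ρ 0)).
Proof. unfold tag0, kpair, is_emp, is_sg, is_up. defin. Qed.

Lemma defin_tag1 : defin (fun ρ => tag1 (ρ 1) (ρ 0)).
Proof. unfold tag1, kpair, is_emp, is_sg, is_up. defin. Qed.

(** [!] and [?] are two-valued, so the falsity half of each [⇔] is the De Morgan dual of its truth
    half. What remains matches the two components that [W_make] takes. *)
Lemma pr_iff p a b : pr p a b <-> forall z,
  (inT z p <-> (exists x, tag0 z x /\ inT x a) \/ (exists y, tag1 z y /\ inT y b)) /\
  (~ inF z p <-> (exists x, tag0 z x /\ ~ inF x a) \/ (exists y, tag1 z y /\ ~ inF y b)).
Proof.
  assert (Hdual : forall P Q : W -> W -> Prop, forall z, (forall x, ~ P z x \/ ~ Q z x) <->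
    ~ exists x, P z x /\ Q z x).
  { intros P Q z. split.
    - intros H (x & HP & HQ). destruct (H x); auto.
    - intros H x. apply not_and_or. intro. apply H. eauto. }
  split; [intros [H1 H2] z; split; [apply H1|apply H2]|].
  intro H. split; intro z; destruct (H z) as [H1 H2].
  - split; [exact H1|]. rewrite H1.
    rewrite (Hdual tag0 (fun _ x => inT x a)), (Hdual tag1 (fun _ x => inT x b)). tauto.
  - split; [exact H2|].
    pose proof (Hdual tag0 (fun _ x => ~ inF x a) z) as D0.
    pose proof (Hdual tag1 (fun _ x => ~ inF x b) z) as D1. cbv beta in D0, D1.
    assert (N : forall A, ~ ~ A <-> A) by (intro; split; [apply NNPP|tauto]).
    setoid_rewrite N in D0. setoid_rewrite N in D1. rewrite D0, D1.
    pose proof (N (inF z p)). tauto.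
Qed.

Lemma pr_ex a b : exists p, pr p a b.
Proof.
  assert (I0 : forall P, small P -> small (fun z => exists x, tag0 z x /\ P x)).
  { intros P HP.
    apply (small_ext _ _ (small_image P (fun x z => tag0 z x) HP defin_tag0 tag0_fun)).
    intro z. split; intros (x & H1 & H2); exists x; auto. }
  assert (I1 : forall P, small P -> small (fun z => exists x, tag1 z x /\ P x)).
  { intros P HP.
    apply (small_ext _ _ (small_image P (fun x z => tag1 z x) HP defin_tag1 tag1_fun)).
    intro z. split; intros (x & H1 & H2); exists x; auto. }
  destruct (W_make _ _ (small_or _ _ (I0 _ (small_T a)) (I1 _ (small_T b)))
    (small_or _ _ (I0 _ (small_F a)) (I1 _ (small_F b)))) as [p Hp].
  exists p. apply pr_iff. intro z. destruct (Hp z) as [H1 H2]. split; [exact H1|].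
  rewrite H2. apply NNPP_iff.
Qed.

Lemma pr_fun p q a b : pr p a b -> pr q a b -> p = q.
Proof.
  intros [H1 H2] [H3 H4]. apply W_ext; intro z.
  - rewrite (proj1 (H1 z)), (proj1 (H3 z)). reflexivity.
  - rewrite (proj2 (H2 z)), (proj2 (H4 z)). reflexivity.
Qed.

(** Each coordinate is decoded from [p] at tagged elements, by injectivity and disjointness of the
    tags. *)
Lemma pr_inj p a b a' b' : pr p a b -> pr p a' b' -> a = a' /\ b = b'.
Proof.
  assert (H0 : forall a b, pr p a b -> forall x z, tag0 z x ->
    (inT x a <-> inT z p) /\ (inF x a <-> inF z p)).
  { intros c d H x z Hz. destruct (proj1 (pr_iff _ _ _) H z) as [H1 H2]. split.
    - rewrite H1. split; [eauto|]. intros [(y & Hy & Hyc)|(y & Hy & _)].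
      + rewrite (tag0_inj z x y Hz Hy). exact Hyc.
      + destruct (tag_disjoint _ _ _ Hz Hy).
    - assert (Hn : ~ inF x c <-> ~ inF z p); [|tauto].
      rewrite H2. split; [eauto|]. intros [(y & Hy & Hyc)|(y & Hy & _)].
      + rewrite (tag0_inj z x y Hz Hy). exact Hyc.
      + destruct (tag_disjoint _ _ _ Hz Hy). }
  assert (H1 : forall a b, pr p a b -> forall x z, tag1 z x ->
    (inT x b <-> inT z p) /\ (inF x b <-> inF z p)).
  { intros c d H x z Hz. destruct (proj1 (pr_iff _ _ _) H z) as [H1 H2]. split.
    - rewrite H1. split; [eauto|]. intros [(y & Hy & _)|(y & Hy & Hyc)].
      + destruct (tag_disjoint _ _ _ Hy Hz).
      + rewrite (tag1_inj z x y Hz Hy). exact Hyc.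
    - assert (Hn : ~ inF x d <-> ~ inF z p); [|tauto].
      rewrite H2. split; [eauto|]. intros [(y & Hy & _)|(y & Hy & Hyc)].
      + destruct (tag_disjoint _ _ _ Hy Hz).
      + rewrite (tag1_inj z x y Hz Hy). exact Hyc. }
  intros H H'. split; apply W_ext; intro x.
  - destruct (tag0_ex x) as [z Hz]. destruct (H0 _ _ H x z Hz), (H0 _ _ H' x z Hz). tauto.
  - destruct (tag0_ex x) as [z Hz]. destruct (H0 _ _ H x z Hz), (H0 _ _ H' x z Hz). tauto.
  - destruct (tag1_ex x) as [z Hz]. destruct (H1 _ _ H x z Hz), (H1 _ _ H' x z Hz). tauto.
  - destruct (tag1_ex x) as [z Hz]. destruct (H1 _ _ H x z Hz), (H1 _ _ H' x z Hz). tauto.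
Qed.

Lemma holds_choice σ : evT σ bz_choice.
Proof.
  intros u [Hu Hne].
  change (forall y, inT y u <-> ~ inF y u) in Hu.
  change (forall x, inT x u -> exists y, inT y x) in Hne.
  destruct (W_choice _ (small_T u) Hne) as (C & HC & Cfun & Cex).
  set (G := fun x y => C x y /\ inT y x).
  assert (Gfun : forall x y z, G x y -> G x z -> y = z).
  { intros x y z [Hy _] [Hz _]. exact (Cfun x y z Hy Hz). }
  assert (HG : defin (fun ρ => G (ρ 0) (ρ 1))) by (unfold G; defin).
  (* The range of the choice function serves as the codomain. *)
  destruct (crisp (fun y => exists x, inT x u /\ G x y)) as [b Hb].
  { exact (small_image _ G (small_T u) HG Gfun). }
  destruct (crisp (fun p => exists x, inT x u /\ exists y, G x y /\ pr p x y)) as [f Hf].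
  { apply (small_image _ (fun x p => exists y, G x y /\ pr p x y) (small_T u)).
    - unfold pr, tag0, tag1, kpair, is_emp, is_sg, is_up. defin.
    - intros x p q (y & Hy & Hp) (y' & Hy' & Hq). rewrite (Gfun x y' y Hy' Hy) in Hq.
      exact (pr_fun _ _ _ _ Hp Hq). }
  set (pinT := fun x y r => exists p, pr p x y /\ inT p r).
  set (pinF := fun x y r => forall p, ~ pr p x y \/ inF p r).
  assert (HT : forall x y, pinT x y f <-> inT x u /\ G x y).
  { intros x y. split.
    - intros (p & Hp & Hpf). apply Hf in Hpf as (x' & Hx' & y' & Hy' & Hp').
      destruct (pr_inj _ _ _ _ _ Hp Hp') as [-> ->]. auto.
    - intros [Hx Hy]. destruct (pr_ex x y) as [p Hp]. exists p. split; [exact Hp|].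
      apply Hf. exists x. split; [exact Hx|]. exists y. auto. }
  (* [f] is crisp, so (x, y) ∈ f is false exactly when it is not true. *)
  assert (HF : forall x y, pinF x y f <-> ~ (inT x u /\ G x y)).
  { intros x y. rewrite <- HT. split.
    - intros H (p & Hp & Hpf). destruct (H p) as [|H']; [auto|].
      apply (proj2 (Hf p)) in H'. apply H', Hf, Hpf.
    - intros H p. destruct (classic (pr p x y)) as [Hp|]; auto. right.
      apply (proj2 (Hf p)). intro Hn. apply H. exists p. split; [exact Hp|].
      apply Hf, Hn. }
  exists f. split; [exists b|].
  - change ((forall y, inT y f <-> ~ inF y f) /\
      (forall z, (inT z f -> exists x y, pr z x y /\ inT x u /\ inT y b) /\
        ((forall x y, ~ pr z x y \/ inF x u \/ inF y b) -> inF z f)) /\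
      (forall x, (inT x u <-> exists y, pinT x y f) /\ (inF x u <-> forall y, pinF x y f)) /\
      (forall x y z, pinT x y f /\ pinT x z f -> y = z)).
    split; [|split; [|split]].
    + intro y. destruct (Hf y) as [H1 H2]. rewrite H1, H2. split; [tauto|apply NNPP].
    + assert (Hsub : forall z, inT z f -> exists x y, pr z x y /\ inT x u /\ inT y b).
      { intros z Hz. apply Hf in Hz as (x & Hx & y & Hy & Hz). exists x, y.
        split; [exact Hz|]. split; [exact Hx|]. apply Hb. eauto. }
      intro z. split; [apply Hsub|]. intro H. apply (proj2 (Hf z)). intro Hz. apply (proj1 (Hf z)) in Hz.
      destruct (Hsub z Hz) as (x & y & Hp & Hx & Hy).
      destruct (H x y) as [Hn|[Hn|Hn]]; [auto|apply Hu in Hx; auto|].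
      apply (proj2 (Hb y)) in Hn. apply Hn, Hb, Hy.
    + intro x.
      assert (Hd : inT x u <-> exists y, pinT x y f).
      { split; [|intros [y Hy]; apply HT in Hy; tauto].
        intro Hx. destruct (Cex x Hx) as (y & Hy & Hyx). exists y. apply HT. split; auto.
        split; auto. }
      (* The falsity half of dom(f) = u rests on the classicality of [u], through [Hu]. *)
      split; [exact Hd|]. rewrite <- (NNPP_iff (inF x u)), <- Hu, Hd. split.
      * intros H y. apply HF. rewrite <- HT. eauto.
      * intros H [y Hy]. apply HT in Hy. apply HF in Hy; auto.
    + intros x y z [Hy Hz]. apply HT in Hy, Hz. exact (Gfun x y z (proj2 Hy) (proj2 Hz)).
  - intros x Hx. destruct (Cex x Hx) as (y & Hy & Hyx). exists y.
    split; [|exact Hyx]. exact (proj2 (HT x y) (conj Hx (conj Hy Hyx))).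
Qed.

Lemma holds_gen n φ : (forall σ, evT σ φ) -> forall σ, evT σ (b_gen n φ).
Proof. induction n; cbn; auto. Qed.

Lemma holds_BZFC φ σ : BZFC φ -> evT σ φ.
Proof.
  intros [ψ []|].
  - apply holds_extensionality.
  - apply holds_classical_superset.
  - apply holds_pairing.
  - apply holds_power.
  - apply holds_union.
  - apply holds_infinity.
  - apply holds_choice.
  - apply holds_gen. apply holds_comprehension.
  - apply holds_gen. apply holds_replacement.
  - apply holds_gen. apply holds_foundation.
  - apply holds_acla.
Qed.

Lemma W_inhabited (x : M) : inhabited W.
Proof.
  destruct (empty_ex E ZF x) as [e He], (pair_ex E ZF e e) as [p Hp].
  assert (HW : in_W E p).
  { apply (in_W_iff E ZF). exists e, e. split; [exact Hp|].
    split; intros y Hy; destruct (He y Hy). }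
  exact (inhabits (exist _ p HW)).
Qed.

End TFModel.

Lemma ZFC_closed φ : ZFC φ -> zf_closed 0 φ.
Proof. intros []; try assumption; cbn; repeat split; lia. Qed.

Lemma BZFC_closed φ : BZFC φ -> b_closed 0 φ.
Proof. intros [ψ []|]; try assumption; cbn; repeat split; lia. Qed.

Theorem theorem7p4 : W_models BZFC.
Proof.
  intros φ Hφ. apply (completeness ZFC ZFC_closed). intros M E ρ HM.
  assert (ZF : forall ψ σ, ZFC ψ -> sat E σ ψ) by auto.
  destruct (W_inhabited E ZF (ρ 0)) as [d].
  (* For a sentence the agreement condition is empty, so the arbitrary [ρ] can be traded for a
     constant assignment in W. *)
  apply (sat_ev E ZF φ 0 ρ (fun _ => d)).
  - apply BZFC_closed, Hφ.
  - lia.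
  - apply (holds_BZFC E ZF), Hφ.
Qed.
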